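(* Let $\mathcal{T},\mathcal{W}\in\mathbb{K}^{R\times R\times K}$. Assume $\mathcal{T}$ has $\mathbb{K}$-rank $R$ with CPD $[\![\mathbf{A},\mathbf{B},\mathbf{C}]\!]$ where $\mathbf{A},\mathbf{B}\in\mathbb{K}^{R\times R}$ are invertible and the columns of $\mathbf{C}$ have unit norm; let $\mathscr{L}_1,\dots,\mathscr{L}_R$ be the spectrum of $\mathcal{T}$ (the spans of the columns of $\mathbf{C}$), and set $\mathcal{E}=\mathcal{T}-\mathcal{W}$. If $\mathscr{W}$ is a JGE value of $\mathcal{W}$ with geometric multiplicity at least one, then $$\min_k\chi(\mathscr{L}_k,\mathscr{W})\leq\sqrt{R}\,\big\|\mathcal{E}\cdot_1\mathbf{A}^{-1}\cdot_2\mathbf{B}^{-1}\cdot_3\mathbf{P}_{\mathscr{W}^\perp}\big\|_{\mathrm{sp}}\leq\frac{\sqrt{R}\,\|\mathcal{E}\|_{\mathrm{sp}}}{\sigma_{\min}(\mathbf{A})\sigma_{\min}(\mathbf{B})},$$ where $\mathbf{P}_{\mathscr{W}^\perp}$ is the orthogonal projection of $\mathbb{K}^K$ onto the orthogonal complement of $\mathscr{W}$. Consequently, if $\mathcal{W}$ is slice mix invertible of border $\mathbb{K}$-rank $R$, then $$\mathrm{sv}[\mathcal{T},\mathcal{W}]\leq\sqrt{R}\,\big\|\mathcal{E}\cdot_1\mathbf{A}^{-1}\cdot_2\mathbf{B}^{-1}\big\|_{\mathrm{sp}}\leq\frac{\sqrt{R}\,\|\mathcal{E}\|_{\mathrm{sp}}}{\sigma_{\min}(\mathbf{A})\sigma_{\min}(\mathbf{B})}.$$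 Moreover, the factor $\sqrt{R}$ may be dropped from all these inequalities in each of the following cases: (1) $K=2$; (2) $\mathcal{W}$ is slice mix invertible and has $\mathbb{K}$-rank $R$ with a CPD $[\![\mathbf{A}_{\mathcal{W}},\mathbf{B}_{\mathcal{W}},\mathbf{C}_{\mathcal{W}}]\!]$ in which $\mathbf{A}_{\mathcal{W}}=\mathbf{A}$ or $\mathbf{B}_{\mathcal{W}}=\mathbf{B}$. In particular, in these cases $\mathrm{sv}[\mathcal{T},\mathcal{W}]\leq\|\mathcal{E}\cdot_1\mathbf{A}^{-1}\cdot_2\mathbf{B}^{-1}\|_{\mathrm{sp}}\leq\|\mathcal{E}\|_{\mathrm{sp}}/(\sigma_{\min}(\mathbf{A})\sigma_{\min}(\mathbf{B}))$.
   Context: $\mathbb{K}$ denotes $\mathbb{R}$ or $\mathbb{C}$; $\sigma_{\min}$ is the smallest singular value; $\cdot_i\mathbf{M}$ applies $\mathbf{M}$ to every mode-$i$ fiber. CPD $[\![\mathbf{A},\mathbf{B},\mathbf{C}]\!]=\sum_r\mathbf{a}_r\otimes\mathbf{b}_r\otimes\mathbf{c}_r$ with the minimal number of terms; $\mathbb{K}$-rank and border $\mathbb{K}$-rank (least $R$ such that the tensor is a limit of tensors of $\mathbb{K}$-rank at most $R$) as usual. For $\mathcal{X}$ with slices $\mathbf{X}_k$: slice mix invertible means some linear combination of slices is invertible; a nonzero $\mathbf{x}$ is a JGE vector if $\mathbf{X}_\ell\mathbf{x}=\lambda_\ell\mathbf{y}$ for all $\ell$ for some $\boldsymbol{\lambda}$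 and nonzero $\mathbf{y}$, and $\mathrm{span}(\boldsymbol{\lambda})$ is then a JGE value; its geometric multiplicity is the dimension of the span of JGE vectors paired with it. With $p_{\mathcal{X}}(\boldsymbol{\gamma})=\det(\sum_k\gamma_k\mathbf{X}_k)$, if $p_{\mathcal{X}}$ is a product of $R$ linear forms $\prod_r(\sum_k\lambda_{r,k}\gamma_k)$ the spectrum of $\mathcal{X}$ is the list $\mathrm{span}(\boldsymbol{\lambda}_r)$, $r=1,\dots,R$. Chordal metric $\chi$: sine of the angle between one-dimensional subspaces. Spectral variation: $\mathrm{sv}[\mathcal{T}_1,\mathcal{T}_2]=\max_i\min_j\chi(\mathscr{L}_{1,j},\mathscr{L}_{2,i})$ for spectra $\{\mathscr{L}_{1,j}\},\{\mathscr{L}_{2,i}\}$. Spectral norm $\|\mathcal{M}\|_{\mathrm{sp}}=\max_{\|\mathbf{x}\|=\|\mathbf{y}\|=\|\mathbf{z}\|=1}|\mathcal{M}\cdot_1\mathbf{x}\cdot_2\mathbf{y}\cdot_3\mathbf{z}|$. *)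

(* Defs.v *)
(* R : realType (mathcomp-reals), K = R or C realised as the
   subset of the complex numbers R[i] (real_closed.complex) selected by a flag. *)
From HB Require Import structures.
From mathcomp Require Import all_boot all_order all_algebra.
From mathcomp Require Import complex.
From mathcomp Require Import boolp classical_sets reals.
Set Implicit Arguments. Unset Strict Implicit. Unset Printing Implicit Defensive.
Import Order.TTheory GRing.Theory Num.Theory.
Local Open Scope ring_scope.
Local Open Scope classical_set_scope.

Section Defs.
Variable R : realType.
Local Notation C := (R[i]).

Definition inK (realK : bool) (z : C) : bool := realK ==> (complex.Im z == 0).
Definition mxK (realK : bool) m n (M : 'M[C]_(m, n)) : Prop :=
  forall i j, inK realK (M i j).

Definition cmod (z : C) : R := Num.sqrt (complex.Re z ^+ 2 + complex.Im z ^+ 2).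

Definition vnorm n (x : 'cV[C]_n) : R := Num.sqrt (\sum_i cmod (x i 0) ^+ 2).
Definition cinner n (u v : 'cV[C]_n) : C := \sum_i (u i 0)^* * v i 0.
Definition ctr m n (M : 'M[C]_(m, n)) : 'M[C]_(n, m) := (map_mx Num.conj M)^T.

Definition tensor (I J K : nat) := 'I_I -> 'I_J -> 'I_K -> C.

Definition tsub I J K (X Y : tensor I J K) : tensor I J K :=
  fun i j k => X i j k - Y i j k.

Definition mode1 I J K I' (X : tensor I J K) (M : 'M[C]_(I', I)) : tensor I' J K :=
  fun i j k => \sum_l M i l * X l j k.
Definition mode2 I J K J' (X : tensor I J K) (M : 'M[C]_(J', J)) : tensor I J' K :=
  fun i j k => \sum_l M j l * X i l k.
Definition mode3 I J K K' (X : tensor I J K) (M : 'M[C]_(K', K)) : tensor I J K' :=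
  fun i j k => \sum_l M k l * X i j l.

Definition contract I J K (X : tensor I J K) (x : 'cV[C]_I) (y : 'cV[C]_J)
  (z : 'cV[C]_K) : C :=
  \sum_i \sum_j \sum_k X i j k * x i 0 * y j 0 * z k 0.

Definition spnorm (realK : bool) I J K (X : tensor I J K) : R :=
  sup [set t : R | exists (x : 'cV[C]_I) (y : 'cV[C]_J) (z : 'cV[C]_K),
          [/\ mxK realK x, mxK realK y, mxK realK z,
              vnorm x = 1 /\ vnorm y = 1 /\ vnorm z = 1 &
              t = cmod (contract X x y z)]].

Definition sigma_min n (A : 'M[C]_n) : R :=
  Num.sqrt (inf [set complex.Re l | l in [set l : C | eigenvalue (ctr A *m A) l]]).

Definition cpd I J K n (A : 'M[C]_(I, n)) (B : 'M[C]_(J, n)) (Cm : 'M[C]_(K, n))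
  : tensor I J K := fun i j k => \sum_r A i r * B j r * Cm k r.

Definition is_cpd (realK : bool) I J K n (X : tensor I J K)
  (A : 'M[C]_(I, n)) (B : 'M[C]_(J, n)) (Cm : 'M[C]_(K, n)) : Prop :=
  [/\ mxK realK A, mxK realK B, mxK realK Cm &
      forall i j k, X i j k = cpd A B Cm i j k].

Definition Krank_le (realK : bool) I J K (X : tensor I J K) (n : nat) : Prop :=
  exists (A : 'M[C]_(I, n)) (B : 'M[C]_(J, n)) (Cm : 'M[C]_(K, n)),
    is_cpd realK X A B Cm.
Definition Krank (realK : bool) I J K (X : tensor I J K) (n : nat) : Prop :=
  Krank_le realK X n /\ forall m, Krank_le realK X m -> (n <= m)%N.

Definition bKrank_le (realK : bool) I J K (X : tensor I J K) (n : nat) : Prop :=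
  forall eps : R, 0 < eps -> exists Y : tensor I J K,
    Krank_le realK Y n /\ forall i j k, cmod (X i j k - Y i j k) < eps.
Definition bKrank (realK : bool) I J K (X : tensor I J K) (n : nat) : Prop :=
  bKrank_le realK X n /\ forall m, bKrank_le realK X m -> (n <= m)%N.

Definition slice I J K (X : tensor I J K) (l : 'I_K) : 'M[C]_(I, J) :=
  \matrix_(i, j) X i j l.
Definition slice_mix I K (X : tensor I I K) (g : 'cV[C]_K) : 'M[C]_I :=
  \sum_l g l 0 *: slice X l.
Definition slice_mix_invertible (realK : bool) I K (X : tensor I I K) : Prop :=
  exists g : 'cV[C]_K, mxK realK g /\ slice_mix X g \in unitmx.
Definition pX I K (X : tensor I I K) (g : 'cV[C]_K) : C := \det (slice_mix X g).

Definition is_spectrum (realK : bool) I K (X : tensor I I K) (L : 'M[C]_(K, I)) : Prop :=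
  mxK realK L /\
  forall g : 'cV[C]_K, mxK realK g -> pX X g = \prod_r (\sum_k L k r * g k 0).

(* span(w) is a JGE value of X (paired with at least one JGE vector, i.e.
   geometric multiplicity >= 1) *)
Definition JGE_value (realK : bool) I K (X : tensor I I K) (w : 'cV[C]_K) : Prop :=
  [/\ mxK realK w, w != 0 &
      exists (x y : 'cV[C]_I), [/\ mxK realK x, mxK realK y, x != 0, y != 0 &
        forall l, slice X l *m x = w l 0 *: y]].

(* chordal metric between span(u) and span(v): sine of the angle *)
Definition chordal K (u v : 'cV[C]_K) : R :=
  Num.sqrt (1 - cmod (cinner u v) ^+ 2 / (vnorm u ^+ 2 * vnorm v ^+ 2)).

Definition proj_perp K (w : 'cV[C]_K) : 'M[C]_K :=
  1%:M - (((vnorm w ^+ 2)^-1)%:C)%C *: (w *m ctr w).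

(* spectral variation sv[T1,T2] when the spectrum of T1 is spanned by the
   columns of L1 and that of T2 by the columns of L2 *)
Definition spec_var K n (L1 L2 : 'M[C]_(K, n)) : R :=
  \big[Num.max/0]_(i < n) \big[Num.min/1]_(j < n) chordal (col j L1) (col i L2).

(* all inequalities of the theorem, with the factor s (sqrt R, or 1) in
   front of the bounds; E = T - W *)
Definition bounds (realK : bool) n K (T W : tensor n n K)
  (A B : 'M[C]_n) (Cm : 'M[C]_(K, n)) (s : R) : Prop :=
  let E := tsub T W in
  let EAB := mode2 (mode1 E (invmx A)) (invmx B) in
  let rhs := s * spnorm realK E / (sigma_min A * sigma_min B) in
  (forall w : 'cV[C]_K, JGE_value realK W w ->
     \big[Num.min/1]_(k < n) chordal (col k Cm) w
        <= s * spnorm realK (mode3 EAB (proj_perp w))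
     /\ s * spnorm realK (mode3 EAB (proj_perp w)) <= rhs)
  /\
  (slice_mix_invertible realK W -> bKrank realK W n ->
     (exists L : 'M[C]_(K, n), is_spectrum realK W L) /\
     forall L : 'M[C]_(K, n), is_spectrum realK W L ->
       spec_var Cm L <= s * spnorm realK EAB /\ s * spnorm realK EAB <= rhs).
End Defs.

(* Main.v *)
(** Write T_l = A diag(c_l) B^T for the slices of T, and let (w, x) be a JGE
    pair of W, so that W_l x = w_l y. Contracting the third mode of W with the
    projection orthogonal to w kills x, hence after multiplication by A^-1 and
    B^-1 the error tensor acts on x' = B^T x as the diagonal matrices built from
    the projections of the columns of C, whose norms are the chordal distances.
    Testing against a largest coordinate of x' costs the factor sqrt R; when
    K = 2 the projection has rank one and a single diagonal matrix is involved,
    and when W shares a factor with T a diagonal entry can be read off directly.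

    For W of border rank R with invertible mix M, the matrices M^-1 W_l commute
    and, over the reals, have real eigenvalues, since both facts are closed
    conditions holding at rank R. Joint triangularization gives the spectrum,
    and every linear factor of det(sum_k g_k W_k) is shown to be a JGE value. *)
Require Import Defs.
From HB Require Import structures.
From mathcomp Require Import all_boot all_order all_algebra.
From mathcomp Require Import complex.
From mathcomp Require Import boolp classical_sets reals.
From mathcomp Require Import spectral ring lra.
Set Implicit Arguments. Unset Strict Implicit. Unset Printing Implicit Defensive.
Import Order.TTheory GRing.Theory Num.Theory.
Local Open Scope ring_scope.

(** * Scalars and matrices over K, Euclidean norms, contractions and the spectral norm *)

Section Norms.
Variable R : realType.
Local Notation C := (R[i]).
Implicit Types (b : bool).

(** For K = R, membership becomes invariance under conjugation, a field morphism; closure of [mxK]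
    under matrix operations then follows from the morphism properties of [map_mx]. *)
Lemma inKP b (z : C) : inK b z <-> (b -> z^* = z).
Proof.
have -> : inK b z = (b ==> (z^* == z)).
  by congr (_ ==> _); case: z => x y; rewrite eq_complex /= eqxx /= eqNr.
by split=> [/implyP h /h /eqP|h]; last by apply/implyP => /h ->.
Qed.

Lemma mxKP b m n (M : 'M[C]_(m, n)) :
  mxK b M <-> (b -> map_mx Num.conj M = M).
Proof.
split=> [MK b1|MK i j]; first by apply/matrixP => i j; rewrite mxE; apply: (inKP b _).1.
by apply/inKP => /MK /matrixP /(_ i j); rewrite mxE.
Qed.

Lemma mxKM b m n p (M : 'M[C]_(m, n)) (N : 'M[C]_(n, p)) :
  mxK b M -> mxK b N -> mxK b (M *m N).
Proof.
move=> /mxKP MK /mxKP NK; apply/mxKP => b1.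
by rewrite map_mxM /= MK // NK.
Qed.

Lemma mxKB b m n (M N : 'M[C]_(m, n)) : mxK b M -> mxK b N -> mxK b (M - N).
Proof.
move=> /mxKP MK /mxKP NK; apply/mxKP => b1.
by rewrite map_mxB /= MK // NK.
Qed.

Lemma mxK1 b n : mxK b (1%:M : 'M[C]_n).
Proof. by apply/mxKP => _; rewrite map_mx1. Qed.

Lemma mxK_tr b m n (M : 'M[C]_(m, n)) : mxK b M -> mxK b M^T.
Proof. by move=> MK i j; rewrite mxE. Qed.

Lemma mxK_conj b m n (M : 'M[C]_(m, n)) : mxK b M -> mxK b (map_mx Num.conj M).
Proof. by move=> /mxKP MK; apply/mxKP => b1; rewrite MK // MK. Qed.

Lemma mxK_inv b n (M : 'M[C]_n) : mxK b M -> mxK b (invmx M).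
Proof. by move=> /mxKP MK; apply/mxKP => b1; rewrite map_invmx /= MK. Qed.

Lemma mxKZ b m n (c : C) (M : 'M[C]_(m, n)) :
  inK b c -> mxK b M -> mxK b (c *: M).
Proof.
move=> /inKP cK /mxKP MK; apply/mxKP => b1.
by rewrite map_mxZ MK //= cK.
Qed.

Lemma mxK_col b m n (M : 'M[C]_(m, n)) j : mxK b M -> mxK b (col j M).
Proof. by move=> MK i k; rewrite mxE. Qed.

Lemma mxK_delta b n (r : 'I_n) : mxK b (delta_mx r 0 : 'cV[C]_n).
Proof. by apply/mxKP => _; rewrite map_delta_mx. Qed.

Lemma inK_real b (a : R) : inK b (a%:C)%C.
Proof. by apply/implyP => _ /=. Qed.

Lemma cmodE (z : C) : ((cmod z)%:C)%C = `|z|.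
Proof. by rewrite normc_def. Qed.

Lemma cmod_ge0 (z : C) : 0 <= cmod z.
Proof. exact: sqrtr_ge0. Qed.

Lemma cmodM (z1 z2 : C) : cmod (z1 * z2) = cmod z1 * cmod z2.
Proof. by apply: complexI; rewrite rmorphM /= !cmodE normrM. Qed.

Lemma cmodD (z1 z2 : C) : cmod (z1 + z2) <= cmod z1 + cmod z2.
Proof. by rewrite -lecR rmorphD /= !cmodE ler_normD. Qed.

Lemma cmodN (z : C) : cmod (- z) = cmod z.
Proof. by apply: complexI; rewrite /= !cmodE normrN. Qed.

Lemma cmodJ (z : C) : cmod z^* = cmod z.
Proof. by apply: complexI; rewrite /= !cmodE norm_conjC. Qed.

Lemma cmod0 : cmod (0 : C) = 0.
Proof. by apply: complexI; rewrite /= cmodE normr0. Qed.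

Lemma cmod1 : cmod (1 : C) = 1.
Proof. by apply: complexI; rewrite /= cmodE normr1. Qed.

Lemma cmod_eq0 (z : C) : (cmod z == 0) = (z == 0).
Proof. by rewrite -(inj_eq (@complexI R)) cmodE normr_eq0. Qed.

Lemma cmod_gt0 (z : C) : (0 < cmod z) = (z != 0).
Proof. by rewrite lt_def cmod_ge0 andbT cmod_eq0. Qed.

Lemma cmod_real (a : R) : 0 <= a -> cmod (a%:C)%C = a.
Proof. by move=> a0; apply: complexI; rewrite cmodE ger0_norm // ler0c. Qed.

Lemma cmod_prod (I : Type) (s : seq I) (P : pred I) (F : I -> C) :
  cmod (\prod_(i <- s | P i) F i) = \prod_(i <- s | P i) cmod (F i).
Proof. exact: (big_morph _ cmodM cmod1). Qed.

Lemma cmod_sum (I : Type) (s : seq I) (P : pred I) (F : I -> C) :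
  cmod (\sum_(i <- s | P i) F i) <= \sum_(i <- s | P i) cmod (F i).
Proof.
elim/big_rec2: _ => [|i y x _ h]; first by rewrite cmod0.
by apply: le_trans (cmodD _ _) _; rewrite lerD2l.
Qed.

Lemma cmod_sqr (z : C) : ((cmod z ^+ 2)%:C)%C = z^* * z.
Proof. by rewrite rmorphXn /= cmodE normCKC. Qed.

Lemma vnorm_ge0 n (x : 'cV[C]_n) : 0 <= vnorm x.
Proof. exact: sqrtr_ge0. Qed.

Lemma sqr_vnorm n (x : 'cV[C]_n) : vnorm x ^+ 2 = \sum_i cmod (x i 0) ^+ 2.
Proof. by rewrite sqr_sqrtr // sumr_ge0 // => i _; rewrite sqr_ge0. Qed.

Lemma cinnerE n (u v : 'cV[C]_n) : cinner u v = (ctr u *m v) 0 0.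
Proof. by rewrite mxE; apply: eq_bigr => i _; rewrite !mxE. Qed.

Lemma cinner_id n (x : 'cV[C]_n) : cinner x x = ((vnorm x ^+ 2)%:C)%C.
Proof.
by rewrite sqr_vnorm rmorph_sum; apply: eq_bigr => i _; rewrite /= cmod_sqr.
Qed.

Lemma vnorm_eq0 n (x : 'cV[C]_n) : (vnorm x == 0) = (x == 0).
Proof.
rewrite -(sqrf_eq0 (vnorm x)) sqr_vnorm psumr_eq0; last by move=> i _; apply: sqr_ge0.
apply/allP/eqP => [h|-> i _]; last by rewrite /= mxE cmod0 expr0n eqxx.
apply/matrixP => i j; rewrite ord1 mxE; apply/eqP.
by rewrite -cmod_eq0 -(sqrf_eq0 (cmod _)); apply: (h i); rewrite mem_index_enum.
Qed.

Lemma vnorm_gt0 n (x : 'cV[C]_n) : (0 < vnorm x) = (x != 0).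
Proof. by rewrite lt_def vnorm_ge0 andbT vnorm_eq0. Qed.

Lemma vnormZ n (c : C) (x : 'cV[C]_n) : vnorm (c *: x) = cmod c * vnorm x.
Proof.
apply/eqP; rewrite -(@eqrXn2 _ 2) // ?mulr_ge0 ?cmod_ge0 ?vnorm_ge0 //.
rewrite exprMn !sqr_vnorm mulr_sumr; apply/eqP; apply: eq_bigr => i _.
by rewrite mxE cmodM exprMn.
Qed.

Lemma vnormJ n (x : 'cV[C]_n) : vnorm (map_mx Num.conj x) = vnorm x.
Proof. by congr Num.sqrt; apply: eq_bigr => i _; rewrite mxE cmodJ. Qed.

Lemma vnorm_delta n (r : 'I_n) : vnorm (delta_mx r 0 : 'cV[C]_n) = 1.
Proof.
rewrite -[RHS]sqrtr1; congr Num.sqrt; rewrite (bigD1 r) //= big1 ?addr0.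
  by rewrite mxE !eqxx /= cmod1 expr1n.
by move=> i /negbTE ir; rewrite mxE ir /= cmod0 expr0n.
Qed.

Lemma cmod_le_vnorm n (x : 'cV[C]_n) i : cmod (x i 0) <= vnorm x.
Proof.
rewrite -(@ler_pXn2r _ 2) ?nnegrE ?cmod_ge0 ?vnorm_ge0 // sqr_vnorm.
by rewrite (bigD1 i) //= lerDl sumr_ge0 // => j _; rewrite sqr_ge0.
Qed.

Section Contract.
Variables I J K : nat.
Implicit Types X : tensor R I J K.

Lemma contract_mode1 I' X (M : 'M_(I', I)) x y z :
  contract (mode1 X M) x y z = contract X (M^T *m x) y z.
Proof.
rewrite /contract /mode1.
under eq_bigr => i _.
  under eq_bigr => j _.
    under eq_bigr => k _ do rewrite !mulr_suml.
    rewrite exchange_big /=; over.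
  rewrite exchange_big /=; over.
rewrite exchange_big /=; apply: eq_bigr => l _.
rewrite exchange_big /=; apply: eq_bigr => j _.
rewrite exchange_big /=; apply: eq_bigr => k _.
rewrite mxE mulr_sumr !mulr_suml; apply: eq_bigr => i _.
by rewrite mxE; ring.
Qed.

Lemma contract_mode2 J' X (M : 'M_(J', J)) x y z :
  contract (mode2 X M) x y z = contract X x (M^T *m y) z.
Proof.
rewrite /contract /mode2; apply: eq_bigr => i _.
under eq_bigr => j _.
  under eq_bigr => k _ do rewrite !mulr_suml.
  rewrite exchange_big /=; over.
rewrite exchange_big /=; apply: eq_bigr => l _.
rewrite exchange_big /=; apply: eq_bigr => k _.
rewrite mxE mulr_sumr !mulr_suml; apply: eq_bigr => j _.
by rewrite mxE; ring.
Qed.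

Lemma contract_mode3 K' X (M : 'M_(K', K)) x y z :
  contract (mode3 X M) x y z = contract X x y (M^T *m z).
Proof.
rewrite /contract /mode3; apply: eq_bigr => i _; apply: eq_bigr => j _.
under eq_bigr => k _ do rewrite !mulr_suml.
rewrite exchange_big /=; apply: eq_bigr => l _.
rewrite mxE mulr_sumr; apply: eq_bigr => k _.
by rewrite mxE; ring.
Qed.

Lemma contractZ X (a1 a2 a3 : C) x y z :
  contract X (a1 *: x) (a2 *: y) (a3 *: z) = a1 * a2 * a3 * contract X x y z.
Proof.
rewrite /contract !mulr_sumr; apply: eq_bigr => i _.
rewrite !mulr_sumr; apply: eq_bigr => j _.
rewrite !mulr_sumr; apply: eq_bigr => k _.
by rewrite !mxE; ring.
Qed.

(** This crude entrywise bound makes the set that defines [spnorm] bounded above, so that its [sup]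
    is a genuine supremum. *)
Lemma cmod_contract_le X x y z :
  cmod (contract X x y z)
    <= (\sum_i \sum_j \sum_k cmod (X i j k)) * (vnorm x * vnorm y * vnorm z).
Proof.
rewrite /contract !mulr_suml; apply: le_trans (cmod_sum _ _ _) _.
apply: ler_sum => i _; apply: le_trans (cmod_sum _ _ _) _.
rewrite mulr_suml; apply: ler_sum => j _; apply: le_trans (cmod_sum _ _ _) _.
rewrite mulr_suml; apply: ler_sum => k _; rewrite !cmodM -!mulrA.
by rewrite !ler_pM ?mulr_ge0 ?cmod_ge0 ?cmod_le_vnorm.
Qed.

Lemma spnorm_le b X c : 0 <= c ->
  (forall x y z, mxK b x -> mxK b y -> mxK b z ->
     vnorm x = 1 -> vnorm y = 1 -> vnorm z = 1 -> cmod (contract X x y z) <= c) ->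
  spnorm b X <= c.
Proof.
move=> c0 h; rewrite /spnorm; set S := [set t | _]%classic.
(* In dimension zero there are no unit vectors, and the supremum of the empty set is 0 by
   convention. *)
have [->|S0] := eqVneq S set0; first by rewrite sup0.
apply: ge_sup; first exact/set0P.
by move=> _ [x [y [z [xK yK zK [x1 [y1 z1]] ->]]]]; apply: h.
Qed.

Lemma spnorm_ge0 b X : 0 <= spnorm b X.
Proof.
rewrite /spnorm; set S := [set t | _]%classic.
have [->|/set0P[t St]] := eqVneq S set0; first by rewrite sup0.
have St' := St; case: St' => x [y [z [_ _ _ _ tE]]].
apply: le_trans (_ : t <= _); first by rewrite tE cmod_ge0.
apply: ub_le_sup => //; exists (\sum_i \sum_j \sum_k cmod (X i j k)).
move=> _ [x' [y' [z' [_ _ _ [x1 [y1 z1]] ->]]]].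
by apply: le_trans (cmod_contract_le _ _ _ _) _; rewrite x1 y1 z1 !mulr1.
Qed.

Lemma contract_le_spnorm b X x y z : mxK b x -> mxK b y -> mxK b z ->
  cmod (contract X x y z) <= spnorm b X * (vnorm x * vnorm y * vnorm z).
Proof.
move=> xK yK zK.
have [|] := boolP [&& vnorm x != 0, vnorm y != 0 & vnorm z != 0]; last first.
  rewrite !negb_and !negbK => h; apply: le_trans (cmod_contract_le _ _ _ _) _.
  suff -> : vnorm x * vnorm y * vnorm z = 0 by rewrite !mulr0.
  by case/or3P: h => /eqP ->; rewrite ?mulr0 ?mul0r.
case/and3P => x0 y0 z0.
pose nrm n (u : 'cV[C]_n) := ((vnorm u)^-1%:C)%C *: u.
have nrm1 n (u : 'cV[C]_n) : vnorm u != 0 -> vnorm (nrm n u) = 1.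
  by move=> u0; rewrite vnormZ cmod_real ?invr_ge0 ?vnorm_ge0 // mulVf.
have nrmE n (u : 'cV[C]_n) : vnorm u != 0 -> u = ((vnorm u)%:C)%C *: nrm n u.
  by move=> u0; rewrite scalerA -rmorphM /= mulfV // scale1r.
have nrmK n (u : 'cV[C]_n) : mxK b u -> mxK b (nrm n u).
  by move=> uK; apply: mxKZ uK; apply: inK_real.
rewrite {1}(nrmE _ _ x0) {1}(nrmE _ _ y0) {1}(nrmE _ _ z0) contractZ.
rewrite -!rmorphM cmodM cmod_real ?mulr_ge0 ?vnorm_ge0 // mulrC.
rewrite ler_wpM2r ?mulr_ge0 ?vnorm_ge0 //.
apply: ub_le_sup; last first.
  exists (nrm _ x), (nrm _ y), (nrm _ z); split; by [apply: nrmK|rewrite ?nrm1].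
exists (\sum_i \sum_j \sum_k cmod (X i j k)).
move=> _ [x' [y' [z' [_ _ _ [x1 [y1 z1]] ->]]]].
by apply: le_trans (cmod_contract_le _ _ _ _) _; rewrite x1 y1 z1 !mulr1.
Qed.

End Contract.
End Norms.

(** * Adjoints, orthogonal projections and the smallest singular value *)

Section Adjoint.
Variable R : realType.
Local Notation C := (R[i]).

Lemma ctrM m n p (M : 'M[C]_(m, n)) (N : 'M[C]_(n, p)) :
  ctr (M *m N) = ctr N *m ctr M.
Proof. by rewrite /ctr map_mxM trmx_mul. Qed.

Lemma ctrK m n : cancel (@ctr R m n) (@ctr R n m).
Proof. by move=> M; apply/matrixP => i j; rewrite !mxE conjCK. Qed.

Lemma cinner_adj m n (M : 'M[C]_(m, n)) u v :
  cinner u (M *m v) = cinner (ctr M *m u) v.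
Proof. by rewrite !cinnerE ctrM ctrK mulmxA. Qed.

Lemma conj_cinner n (u v : 'cV[C]_n) : (cinner u v)^* = cinner v u.
Proof.
rewrite /cinner rmorph_sum; apply: eq_bigr => i _.
by rewrite rmorphM /= conjCK mulrC.
Qed.

Lemma conj_real (a : R) : ((a%:C)%C : C)^* = (a%:C)%C.
Proof. by apply/eqP; rewrite eq_complex /= oppr0 !eqxx. Qed.

Lemma cinnerZr n (a : C) (u v : 'cV[C]_n) : cinner u (a *: v) = a * cinner u v.
Proof. by rewrite !cinnerE -scalemxAr mxE. Qed.

Section Projection.
Variables (K : nat) (w : 'cV[C]_K).
Hypothesis w0 : w != 0.
Local Notation P := (proj_perp w).

Lemma proj_perp_mul (v : 'cV[C]_K) :
  P *m v = v - (((vnorm w ^+ 2)^-1)%:C * cinner w v)%C *: w.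
Proof.
rewrite mulmxBl mul1mx -scalemxAl -mulmxA -scalerA; congr (_ - _ *: _).
by rewrite [ctr w *m v]mx11_scalar mul_mx_scalar -cinnerE.
Qed.

Lemma proj_perp_id : P *m w = 0.
Proof.
rewrite proj_perp_mul cinner_id -rmorphM /= mulVf ?scale1r ?subrr //.
by rewrite expf_neq0 // vnorm_eq0.
Qed.

Lemma ctr_proj_perp : ctr P = P.
Proof.
apply/matrixP => i j; rewrite !mxE rmorphB rmorphM /= !big_ord1 !mxE.
rewrite !rmorphM /= conjCK conj_real.
by congr (_ - _ * _); [rewrite eq_sym conjC_nat | rewrite mulrC].
Qed.

Lemma tr_proj_perp : P^T = map_mx Num.conj P.
Proof. by rewrite -[in LHS]ctr_proj_perp /ctr trmxK. Qed.

Lemma mxK_proj_perp b : mxK b w -> mxK b P.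
Proof.
move=> wK; apply: mxKB; first exact: mxK1.
apply: mxKZ; first exact: inK_real.
by apply: mxKM => //; apply/mxK_tr/mxK_conj.
Qed.

(** Pythagoras: the projection is self-adjoint and idempotent, so |Pc|^2 reduces to the inner
    product of c and Pc. *)
Lemma sqr_vnorm_proj_perp c :
  vnorm (P *m c) ^+ 2 = vnorm c ^+ 2 - cmod (cinner w c) ^+ 2 / vnorm w ^+ 2.
Proof.
apply: complexI; rewrite -cinner_id cinner_adj ctr_proj_perp.
have -> : P *m (P *m c) = P *m c.
  by rewrite {1}(proj_perp_mul c) mulmxBr -scalemxAr proj_perp_id scaler0 subr0.
rewrite -conj_cinner proj_perp_mul.
have -> (a : C) : cinner c (c - a *: w) = cinner c c - a * cinner c w.
  by rewrite !cinnerE mulmxBr -scalemxAr !mxE.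
rewrite cinner_id -mulrA [cinner w c * _]mulrC -[cinner c w]conj_cinner -cmod_sqr.
by rewrite -rmorphM -rmorphB /= conj_real [_^-1 * _]mulrC.
Qed.

Lemma vnorm_proj_perp_le c : vnorm (P *m c) <= vnorm c.
Proof.
rewrite -(@ler_pXn2r _ 2) ?nnegrE ?vnorm_ge0 // sqr_vnorm_proj_perp.
by rewrite gerBl divr_ge0 ?sqr_ge0.
Qed.

Lemma vnorm_tr_proj_perp_le c : vnorm (P^T *m c) <= vnorm c.
Proof.
rewrite tr_proj_perp -vnormJ map_mxM -map_mx_comp /=.
rewrite (map_mx_id (@conjCK _)) -[leRHS]vnormJ; exact: vnorm_proj_perp_le.
Qed.

Lemma chordalE c : vnorm c = 1 -> chordal c w = vnorm (P *m c).
Proof.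
move=> c1; rewrite -[RHS]ger0_norm ?vnorm_ge0 // -sqrtr_sqr.
by rewrite sqr_vnorm_proj_perp /chordal c1 expr1n mul1r -conj_cinner cmodJ.
Qed.

End Projection.

Lemma map_trmx_ctr m n (M : 'M[C]_(m, n)) : map_mx Num.conj M^T = ctr M.
Proof. by rewrite /ctr map_trmx. Qed.

Section SigmaMin.
Variables (n : nat) (A : 'M[C]_n).
Hypothesis Au : A \in unitmx.

(** [eigenvalue] refers to left eigenvectors, so the adjoint x of one is a right eigenvector for the
    conjugate eigenvalue. Pairing it with itself gives |Ax|^2 = conj(l) |x|^2, and Ax is nonzero. *)
Lemma gram_eigenvalue_gt0 l : eigenvalue (ctr A *m A) l -> 0 < complex.Re l.
Proof.
case/eigenvalueP => u uE u0; pose x := ctr u.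
have x0 : x != 0 by apply: contra_neq u0 => x0; rewrite -[u]ctrK -/x x0 /ctr map_mx0 trmx0.
have Hx : ctr A *m (A *m x) = l^* *: x.
  have := congr1 (@ctr R _ _) uE; rewrite !ctrM ctrK -mulmxA => ->.
  by apply/matrixP => i j; rewrite !mxE rmorphM.
have /(congr1 (@complex.Re R)) : ((vnorm (A *m x) ^+ 2)%:C)%C = l^* * ((vnorm x ^+ 2)%:C)%C.
  by rewrite -!cinner_id -cinnerZr -Hx [RHS]cinner_adj ctrK.
have -> : complex.Re (l^* * ((vnorm x ^+ 2)%:C)%C) = complex.Re l * vnorm x ^+ 2.
  by case: (l) => a b /=; rewrite mulr0 subr0.
move=> /= E; have : 0 < complex.Re l * vnorm x ^+ 2.
  rewrite -E exprn_gt0 // vnorm_gt0; apply: contra_neq x0 => Ax0.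
  by rewrite -[x](mulKmx Au) Ax0 mulmx0.
by rewrite pmulr_lgt0 // exprn_gt0 // vnorm_gt0.
Qed.

(** The eigenvalues are roots of the characteristic polynomial, hence finitely many, so a positive
    minimum bounds the infimum from below; for positive [n] the set is nonempty. *)
Lemma sigma_min_gt0 : (0 < n)%N -> 0 < sigma_min A.
Proof.
move=> n0; rewrite sqrtr_gt0.
have [rs rsE] := closed_field_poly_normal (char_poly (ctr A *m A)).
(* The initial value 1 only caps the minimum, which remains a positive lower bound. *)
pose c := \big[Num.min/1]_(l <- rs | eigenvalue (ctr A *m A) l) complex.Re l.
have c0 : 0 < c by apply: lt_bigmin => // l /gram_eigenvalue_gt0.
apply: lt_le_trans c0 _; apply: lb_le_inf.
  by have [a aE] := eigenvalue_closed (ctr A *m A) n0; exists (complex.Re a), a.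
move=> _ [l /= lE <-]; have lrs : l \in rs.
  have := lE; rewrite eigenvalue_root_char rsE rootZ; last first.
    by rewrite lead_coef_eq0 monic_neq0 // char_poly_monic.
  by rewrite root_prod_XsubC.
by rewrite /c; elim: (rs) lrs => // a s IHs; rewrite inE big_cons => /predU1P[<-|/IHs h];
  rewrite ?lE ?ge_min ?lexx //; case: ifP; rewrite // ge_min h orbT.
Qed.

(** The transpose is the form in which [contract_mode1] and [contract_mode2] move a matrix onto a
    test vector. The Gram matrix of A^T is diagonalised unitarily and its eigenvalues are compared
    with those of A^H A. *)
Lemma sigma_min_le (v : 'cV[C]_n) : sigma_min A * vnorm v <= vnorm (A^T *m v).
Proof.
pose M := A^T; pose G := ctr M *m M.
(* [G] is the conjugate of A A^H, which shares its eigenvalues with A^H A: a left eigenvector u of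
   [G] yields the left eigenvector conj(u) A. *)
have eigG l : eigenvalue G l -> sigma_min A ^+ 2 <= complex.Re l.
  case/eigenvalueP => u uE u0.
  have lH : eigenvalue (ctr A *m A) l^*.
    apply/eigenvalueP; exists (map_mx Num.conj u *m A); last first.
      apply: contra_neq u0 => uA0; apply: (map_mx_inj (f := Num.conj)).
      by rewrite map_mx0 -[LHS](mulmxK Au) uA0 mul0mx.
    rewrite !mulmxA scalemxAl -map_mxZ; congr (_ *m _).
    rewrite -uE !map_mxM /= !mulmxA; congr (_ *m _ *m _).
      by apply/matrixP => i j; rewrite !mxE conjCK.
    by apply/matrixP => i j; rewrite !mxE.
  have Rl : complex.Re l = complex.Re l^* by case: (l).
  rewrite sqr_sqrtr.
    rewrite Rl; apply: ge_inf; last by exists l^*.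
    by exists 0 => _ [k /= /gram_eigenvalue_gt0 /ltW ? <-].
  apply: lb_le_inf; first by exists (complex.Re l^*), l^*.
  by move=> _ [k /= /gram_eigenvalue_gt0 /ltW ? <-].
have Gn : G \is normalmx.
  by apply/normalmxP; rewrite map_trmx_ctr /G ctrM ctrK.
have /orthomx_spectralP := Gn; set P := spectralmx G; set d := spectral_diag G => GE.
have Pun : P \is unitarymx := spectral_unitarymx G.
have Pu : P \in unitmx := spectral_unit G.
have eigd i : eigenvalue G (d 0 i).
  apply/eigenvalueP; exists (row i P).
    rewrite -row_mul {1}GE !mulmxA mulmxV // mul1mx row_mul.
    by rewrite row_diag_mx -scalemxAl -rowE.
  rewrite rowE; apply/negP => /eqP /(congr1 (mulmx^~ (invmx P))).
  rewrite mulmxK // mul0mx => /matrixP /(_ 0 i) /eqP.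
  by rewrite !mxE !eqxx oner_eq0.
have invP : invmx P = ctr P by rewrite invmx_unitary // map_trmx_ctr.
have nP : vnorm (P *m v) ^+ 2 = vnorm v ^+ 2.
  by apply: complexI; rewrite -!cinner_id cinner_adj mulmxA -invP mulVmx // mul1mx.
have nM : vnorm (M *m v) ^+ 2 = \sum_i complex.Re (d 0 i) * cmod ((P *m v) i 0) ^+ 2.
  have : ((vnorm (M *m v) ^+ 2)%:C)%C = cinner (P *m v) (diag_mx d *m (P *m v)).
    have -> : cinner (P *m v) (diag_mx d *m (P *m v)) = cinner v (G *m v).
      by rewrite [in RHS]GE invP -!mulmxA [RHS]cinner_adj ctrK.
    by rewrite -cinner_id /G -mulmxA [RHS]cinner_adj ctrK.
  move=> /(congr1 (@complex.Re R)) /= ->.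
  have ReD : {morph @complex.Re R : x y / x + y} by case=> a1 b1 [a2 b2].
  rewrite /cinner (big_morph _ ReD (erefl : complex.Re 0 = 0)).
  apply: eq_bigr => i _; rewrite mul_diag_mx [X in _ * X]mxE mulrCA -cmod_sqr.
  by case: (d 0 i) => a b /=; rewrite mulr0 subr0.
have s0 : 0 <= sigma_min A by exact: sqrtr_ge0.
rewrite -(@ler_pXn2r _ 2) ?nnegrE ?mulr_ge0 ?vnorm_ge0 //.
rewrite sqr_vnorm in nP; rewrite nM exprMn -nP mulr_sumr.
by apply: ler_sum => i _; rewrite ler_wpM2r ?sqr_ge0 // eigG.
Qed.

End SigmaMin.
End Adjoint.

(** * Distance from a JGE value of W to the spectrum of T *)

Section JointEigenvalueBounds.
Variable R : realType.
Local Notation C := (R[i]).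

Lemma contract_sub I J K (X Y : tensor R I J K) x y z :
  contract (tsub X Y) x y z = contract X x y z - contract Y x y z.
Proof.
rewrite /contract -sumrB; apply: eq_bigr => i _.
rewrite -sumrB; apply: eq_bigr => j _.
by rewrite -sumrB; apply: eq_bigr => k _; rewrite /tsub !mulrBl.
Qed.

Lemma eq_contract I J K (X Y : tensor R I J K) x y z :
  (forall i j k, X i j k = Y i j k) -> contract X x y z = contract Y x y z.
Proof.
move=> XY; apply: eq_bigr => i _; apply: eq_bigr => j _.
by apply: eq_bigr => k _; rewrite XY.
Qed.

Lemma contract_cpd I J K n (A : 'M[C]_(I, n)) (B : 'M_(J, n)) (Cm : 'M_(K, n)) x y z :
  contract (cpd A B Cm) x y z
    = \sum_r (A^T *m x) r 0 * (B^T *m y) r 0 * (Cm^T *m z) r 0.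
Proof.
rewrite /contract /cpd.
under eq_bigr => i _.
  under eq_bigr => j _.
    under eq_bigr => k _ do rewrite !mulr_suml.
    rewrite exchange_big /=; over.
  rewrite exchange_big /=; over.
rewrite exchange_big /=; apply: eq_bigr => r _.
rewrite [(A^T *m x) r 0]mxE !mulr_suml; apply: eq_bigr => i _.
rewrite [(B^T *m y) r 0]mxE mulr_sumr !mulr_suml; apply: eq_bigr => j _.
rewrite [(Cm^T *m z) r 0]mxE mulr_sumr; apply: eq_bigr => k _.
by rewrite !mxE; ring.
Qed.

Lemma contract_slice n K (X : tensor R n n K) x y z :
  contract X x y z = \sum_l z l 0 * (x^T *m (slice X l *m y)) 0 0.
Proof.
rewrite /contract.
under eq_bigr => i _ do rewrite exchange_big /=.
rewrite exchange_big /=; apply: eq_bigr => l _.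
rewrite mxE mulr_sumr; apply: eq_bigr => i _.
rewrite !mxE !mulr_sumr; apply: eq_bigr => j _.
by rewrite !mxE; ring.
Qed.

Section Bounds.
Variables (b : bool) (n K : nat) (T W : tensor R n n K).
Variables (A B : 'M[C]_n) (Cm : 'M[C]_(K, n)).
Hypothesis Tcpd : is_cpd b T A B Cm.
Hypotheses (Au : A \in unitmx) (Bu : B \in unitmx).
Hypothesis Cm1 : forall r : 'I_n, vnorm (col r Cm) = 1.
Local Notation E := (tsub T W).
Local Notation EAB := (mode2 (mode1 E (invmx A)) (invmx B)).

Lemma bigmin_chordal_le w r :
  \big[Num.min/1]_(k < n) chordal (col k Cm) w <= chordal (col r Cm) w.
Proof. exact: (bigmin_le_cond _ (j := r)). Qed.

Lemma vnorm_inv_tr_le m (M : 'M[C]_m) (x : 'cV_m) : (0 < m)%N -> M \in unitmx ->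
  vnorm ((invmx M)^T *m x) <= vnorm x / sigma_min M.
Proof.
move=> m0 Mu; rewrite ler_pdivlMr ?sigma_min_gt0 // mulrC.
apply: le_trans (sigma_min_le Mu _) _.
by rewrite mulmxA -trmx_mul mulVmx // trmx1 mul1mx.
Qed.

Lemma spnorm_mode12_le :
  spnorm b EAB <= spnorm b E / (sigma_min A * sigma_min B).
Proof.
have [AK BK _ _] := Tcpd.
have s0 m (M : 'M[C]_m) : 0 <= sigma_min M by apply: sqrtr_ge0.
apply: spnorm_le; first by rewrite divr_ge0 ?spnorm_ge0 ?mulr_ge0.
move=> x y z xK yK zK x1 y1 z1.
have n0 : (0 < n)%N.
  have : x != 0 by rewrite -vnorm_eq0 x1 oner_eq0.
  by case/matrix0Pn => i _; apply: leq_ltn_trans (ltn_ord i).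
rewrite contract_mode2 contract_mode1.
apply: le_trans (contract_le_spnorm E _ _ zK) _; try by apply: mxKM => //; apply/mxK_tr/mxK_inv.
rewrite z1 mulr1 ler_wpM2l ?spnorm_ge0 // invfM ler_pM ?vnorm_ge0 //.
  by rewrite -[_^-1]mul1r -x1 vnorm_inv_tr_le.
by rewrite -[_^-1]mul1r -y1 vnorm_inv_tr_le.
Qed.

Lemma spnorm_mode3_proj_le (X : tensor R n n K) w : mxK b w -> w != 0 ->
  spnorm b (mode3 X (proj_perp w)) <= spnorm b X.
Proof.
move=> wK w0; apply: spnorm_le; first exact: spnorm_ge0.
move=> x y z xK yK zK x1 y1 z1; rewrite contract_mode3.
have PzK : mxK b ((proj_perp w)^T *m z) by apply: mxKM zK; apply/mxK_tr/mxK_proj_perp.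
apply: le_trans (contract_le_spnorm X xK yK PzK) _.
by rewrite x1 y1 !mul1r ler_piMr ?spnorm_ge0 // -z1 vnorm_tr_proj_perp_le.
Qed.

(** Inverting A and B makes every slice of T diagonal and leaves the W term to be annihilated by the
    choice of test vectors. The third vector is conjugated so that the pairing becomes [cinner]. *)
Lemma contract_EAB w (u v : 'cV[C]_n) (q : 'cV[C]_K) :
  contract (mode3 EAB (proj_perp w)) u v (map_mx Num.conj q)
    = \sum_r u r 0 * v r 0 * cinner q (proj_perp w *m col r Cm)
      - contract W ((invmx A)^T *m u) ((invmx B)^T *m v)
          ((proj_perp w)^T *m map_mx Num.conj q).
Proof.
have [_ _ _ TE] := Tcpd.
rewrite contract_mode3 contract_mode2 contract_mode1 contract_sub; congr (_ - _).
rewrite (eq_contract _ _ _ TE) contract_cpd; apply: eq_bigr => r _.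
rewrite !mulmxA -!trmx_mul !mulVmx // trmx1 !mul1mx; congr (_ * _).
rewrite mxE; apply: eq_bigr => k _; rewrite !mxE mulrC; congr (_ * _).
by apply: eq_bigr => l _; rewrite !mxE.
Qed.

(* Tests [contract_EAB] at [u = e_r] and [q = P c_r], where the diagonal part
   is [v_r |P c_r|^2]. *)
Lemma chordal_le_of_contract w (v : 'cV[C]_n) r : mxK b w -> w != 0 -> mxK b v ->
  contract W ((invmx A)^T *m delta_mx r 0) ((invmx B)^T *m v)
     ((proj_perp w)^T *m map_mx Num.conj (proj_perp w *m col r Cm)) = 0 ->
  cmod (v r 0) * chordal (col r Cm) w
    <= spnorm b (mode3 EAB (proj_perp w)) * vnorm v.
Proof.
move=> wK w0 vK W0; have [_ _ CK _] := Tcpd.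
set c := proj_perp w *m col r Cm in W0 *.
have cK : mxK b c by apply: mxKM; [exact: mxK_proj_perp | exact: mxK_col].
have /= h := contract_le_spnorm (mode3 EAB (proj_perp w)) (mxK_delta R b r) vK (mxK_conj cK).
move: h; rewrite contract_EAB W0 subr0 (bigD1 r) //= big1 ?addr0; last first.
  by move=> i /negbTE ir; rewrite mxE ir !mul0r.
rewrite mxE !eqxx mul1r -/c cinner_id cmodM cmod_real ?sqr_ge0 //.
rewrite vnorm_delta mul1r vnormJ (chordalE w0) // -/c mulrA.
(* A zero projection makes the left side vanish; otherwise one factor |P c_r| is cancelled. *)
have [->|c0] := eqVneq (vnorm c) 0.
  by move=> _; rewrite mulr0 mulr_ge0 ?spnorm_ge0 ?vnorm_ge0.
by rewrite expr2 !mulrA ler_pM2r // lt_def c0 vnorm_ge0.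
Qed.

Section JGE.
Variables (w : 'cV[C]_K) (x y : 'cV[C]_n).
Hypothesis wxy : forall l, slice W l *m x = w l 0 *: y.
Hypothesis w0 : w != 0.

(** Slice l contributes a multiple of w_l, so the third mode is paired with w, and w^T P^T = (P w)^T
    = 0. *)
Lemma contract_JGE_vector u z : contract W u x ((proj_perp w)^T *m z) = 0.
Proof.
rewrite contract_slice.
under eq_bigr => l _ do rewrite wxy -scalemxAr [X in _ * X]mxE mulrA.
rewrite -mulr_suml (_ : \sum_l _ = ((w^T *m (proj_perp w)^T) *m z) 0 0).
  by rewrite -trmx_mul proj_perp_id // trmx0 mul0mx mxE mul0r.
by rewrite -mulmxA [RHS]mxE; apply: eq_bigr => l _; rewrite !mxE mulrC.
Qed.

Hypotheses (wK : mxK b w) (xK : mxK b x) (x0 : x != 0).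

Let x' := B^T *m x.

Let x'K : mxK b x'.
Proof. by apply: mxKM xK; apply: mxK_tr; case: Tcpd. Qed.

Let x'0 : x' != 0.
Proof.
have BTu : B^T \in unitmx by rewrite unitmx_tr.
by apply: contra_neq x0 => h; rewrite -[x](mulKmx BTu) -/x' h mulmx0.
Qed.

Let invBx' : (invmx B)^T *m x' = x.
Proof. by rewrite mulmxA -trmx_mul mulmxV // trmx1 mul1mx. Qed.

Lemma JGE_bound_sqrt :
  \big[Num.min/1]_(k < n) chordal (col k Cm) w
    <= Num.sqrt n%:R * spnorm b (mode3 EAB (proj_perp w)).
Proof.
have /matrix0Pn[i0 [j0 xi0]] := x'0; rewrite ord1 {j0} in xi0.
have [r _ rmax] := @arg_maxP _ _ _ i0 xpredT (fun i => cmod (x' i 0)) isT.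
apply: le_trans (bigmin_chordal_le w r) _.
have xr0 : 0 < cmod (x' r 0).
  by apply: lt_le_trans (rmax i0 isT); rewrite cmod_gt0.
rewrite -(ler_pM2l xr0).
apply: le_trans (chordal_le_of_contract wK w0 x'K _) _.
  by rewrite invBx' contract_JGE_vector.
(* What remains is |x'| <= sqrt n |x'_r|, which holds because r indexes a largest coordinate. *)
rewrite mulrCA mulrC mulrA ler_wpM2r ?spnorm_ge0 //.
rewrite -(@ler_pXn2r _ 2) ?nnegrE ?mulr_ge0 ?vnorm_ge0 ?cmod_ge0 ?sqrtr_ge0 //.
rewrite sqr_vnorm exprMn sqr_sqrtr // mulrC mulr_natr.
rewrite -[_ *+ n](_ : \sum_(i < n) cmod (x' r 0) ^+ 2 = _); last first.
  by rewrite sumr_const card_ord.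
apply: ler_sum => i _; rewrite ler_pXn2r ?nnegrE ?cmod_ge0 //; exact: rmax.
Qed.

(** If coordinate r of [Bw^T *m x] is nonzero, column r of [Cw] is proportional to w and the
    projection kills it. Basis vectors at r can then be used in both modes at no cost, since the
    shared factor removes every other term of W. *)
Lemma JGE_bound_cpd (Aw Bw : 'M[C]_n) (Cw : 'M[C]_(K, n)) :
  Bw \in unitmx -> Aw \in unitmx -> is_cpd b W Aw Bw Cw -> Aw = A \/ Bw = B ->
  \big[Num.min/1]_(k < n) chordal (col k Cm) w
    <= spnorm b (mode3 EAB (proj_perp w)).
Proof.
move=> Bwu Awu [_ _ _ WE] AB.
have BTu : Bw^T \in unitmx by rewrite unitmx_tr.
pose x1 := Bw^T *m x; pose y1 := invmx Aw *m y.
have x10 : x1 != 0 by apply: contra_neq x0 => h; rewrite -[x](mulKmx BTu) -/x1 h mulmx0.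
have /matrix0Pn[r [j0 xr0]] := x10; rewrite ord1 {j0} in xr0.
(* Coordinate r of W_k x = w_k y, after multiplication by the inverse of [Aw]. *)
have cw k : Cw k r * x1 r 0 = w k 0 * y1 r 0.
  have sE : slice W k = Aw *m (diag_mx (row k Cw) *m Bw^T).
    apply/matrixP => i j; rewrite !mxE WE /cpd; apply: eq_bigr => s _.
    by rewrite mul_diag_mx !mxE; ring.
  have : invmx Aw *m (slice W k *m x) = w k 0 *: y1 by rewrite wxy -scalemxAr.
  rewrite sE -!mulmxA mulKmx // => /matrixP /(_ r 0).
  by rewrite mul_diag_mx !mxE => <-.
have Pcw (z : 'cV[C]_K) : (Cw^T *m ((proj_perp w)^T *m z)) r 0 = 0.
  have cE : row r Cw^T = (y1 r 0 / x1 r 0) *: w^T.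
    move: (x1 r 0) (y1 r 0) xr0 cw => a d a0 cw.
    by apply/matrixP => i k; rewrite !mxE ord1 -[LHS](mulfK a0) cw; ring.
  have -> : (Cw^T *m ((proj_perp w)^T *m z)) r 0 =
            (row r Cw^T *m ((proj_perp w)^T *m z)) 0 0.
    by rewrite -row_mul [RHS]mxE.
  rewrite cE -scalemxAl mulmxA -trmx_mul proj_perp_id // trmx0 mul0mx.
  by rewrite scaler0 mxE.
apply: le_trans (bigmin_chordal_le w r) _.
have := @chordal_le_of_contract w (delta_mx r 0) r wK w0 (mxK_delta R b r).
rewrite mxE !eqxx cmod1 mul1r vnorm_delta mulr1; apply.
(* Term r vanishes by the projection, the others because the shared factor turns one test vector
   back into e_r. *)
rewrite (eq_contract _ _ _ WE) contract_cpd big1 // => s _.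
have [->|sr] := eqVneq s r; first by rewrite Pcw mulr0.
have inv0 M : M \in unitmx -> (M^T *m ((invmx M)^T *m (delta_mx r 0 : 'cV_n))) s 0 = 0 :> C.
  by move=> Mu; rewrite mulmxA -trmx_mul mulVmx // trmx1 mul1mx mxE (negbTE sr).
case: AB => <-; first by rewrite [X in X * _ * _]inv0 // !mul0r.
by rewrite [X in _ * X * _]inv0 // mulr0 mul0r.
Qed.

End JGE.
End Bounds.

(** * The sharper bound for K = 2 *)

Section Perp2.
Variable w : 'cV[C]_2.
Hypothesis w0 : w != 0.

(** For nonzero w this spans the orthogonal complement of w in the plane; sign and conjugates are
    chosen so that its inner product with c is the determinant of the pair w, c. *)
Definition perp2 : 'cV[C]_2 := \col_k (if k == 0 then - (w 1 0)^* else (w 0 0)^*).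

Let sum2 (V : nmodType) (F : 'I_2 -> V) : \sum_k F k = F 0 + F 1.
Proof. by rewrite !big_ord_recl big_ord0 addr0; congr (_ + F _); apply: val_inj. Qed.

Lemma cinner_perp2 c : cinner perp2 c = w 0 0 * c 1 0 - w 1 0 * c 0 0.
Proof. by rewrite /cinner sum2 !mxE /= rmorphN /= !conjCK; ring. Qed.

Lemma proj_perp_perp2 : proj_perp w *m perp2 = perp2.
Proof.
rewrite proj_perp_mul -conj_cinner cinner_perp2.
by rewrite [w 1 0 * _]mulrC subrr conjC0 mulr0 scale0r subr0.
Qed.

Lemma vnorm_perp2 : vnorm perp2 = vnorm w.
Proof.
by congr Num.sqrt; rewrite !sum2 !mxE /= cmodN !cmodJ addrC.
Qed.

(* Lagrange's identity |w|^2 |c|^2 = |<w, c>|^2 + |w_0 c_1 - w_1 c_0|^2. *)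
Lemma cmod_cinner_perp2 c :
  cmod (cinner perp2 c) = vnorm w * vnorm (proj_perp w *m c).
Proof.
apply/eqP; rewrite -(@eqrXn2 _ 2) // ?mulr_ge0 ?cmod_ge0 ?vnorm_ge0 // exprMn.
rewrite (sqr_vnorm_proj_perp w0) mulrBr [_ * (_ / _)]mulrC divfK; last first.
  by rewrite expf_neq0 // vnorm_eq0.
have key (a1 a2 c1 c2 : C) : (a1 * c2 - a2 * c1)^* * (a1 * c2 - a2 * c1) =
    (a1^* * a1 + a2^* * a2) * (c1^* * c1 + c2^* * c2)
      - (a1^* * c1 + a2^* * c2)^* * (a1^* * c1 + a2^* * c2).
  by rewrite !(rmorphB, rmorphD, rmorphM) /= !conjCK; ring.
apply/eqP/complexI; rewrite cmod_sqr cinner_perp2 key [RHS]rmorphB /= cmod_sqr.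
congr (_ - _); last by rewrite /cinner sum2.
by rewrite rmorphM /= -!cinner_id /cinner !sum2.
Qed.

End Perp2.

(** Let D be the diagonal matrix of the inner products of p = [perp2 w] with the columns of C; their
    moduli are |w| times the chordal distances, so |D x'| >= m |w| |x'|. Testing against conj(D x'),
    x' and conj(p) gives |D x'|^2 <= S |D x'| |x'| |w|. No coordinate is singled out, hence no
    factor is lost. *)
Lemma JGE_bound_dim2 (b : bool) n (T W : tensor R n n 2)
    (A B : 'M[C]_n) (Cm : 'M[C]_(2, n)) (w : 'cV[C]_2) (x y : 'cV[C]_n) :
  is_cpd b T A B Cm -> A \in unitmx -> B \in unitmx ->
  (forall r : 'I_n, vnorm (col r Cm) = 1) ->
  mxK b w -> w != 0 -> mxK b x -> x != 0 ->
  (forall l, slice W l *m x = w l 0 *: y) ->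
  \big[Num.min/1]_(k < n) chordal (col k Cm) w
    <= spnorm b (mode3 (mode2 (mode1 (tsub T W) (invmx A)) (invmx B)) (proj_perp w)).
Proof.
move=> Tcpd Au Bu Cm1 wK w0 xK x0 wxy.
have [AK BK CK TE] := Tcpd.
set m := \big[Num.min/1]_(k < n) _; set S := spnorm _ _.
pose x' := B^T *m x; pose p := perp2 w.
have BTu : B^T \in unitmx by rewrite unitmx_tr.
have x'0 : x' != 0 by apply: contra_neq x0 => h; rewrite -[x](mulKmx BTu) -/x' h mulmx0.
have x'K : mxK b x' by apply: mxKM xK; apply: mxK_tr.
have pK : mxK b p.
  apply/mxKP => b1; move/mxKP/(_ b1)/matrixP: wK => wK.
  have {}wK k : (w k 0)^* = w k 0 by have := wK k 0; rewrite mxE.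
  by apply/matrixP => i j; rewrite !mxE; case: ifP => _; rewrite ?rmorphN /= !wK.
pose t r := cinner p (col r Cm).
pose u : 'cV[C]_n := map_mx Num.conj (\col_r (x' r 0 * t r)).
have uK : mxK b u.
  apply: mxK_conj; have -> : \col_r (x' r 0 * t r) = diag_mx (map_mx Num.conj p^T *m Cm) *m x'.
    apply/matrixP => i j; rewrite mul_diag_mx mxE [RHS]mxE ord1 mulrC; congr (_ * _).
    by rewrite mxE; apply: eq_bigr => k _; rewrite !mxE.
  apply: mxKM x'K; move=> i j; rewrite mxE; case: eqP => _; last exact: (inK_real b 0).
  by rewrite mulr1n; apply: mxKM CK _ _; apply/mxK_conj/mxK_tr.
have := contract_le_spnorm
  (mode3 (mode2 (mode1 (tsub T W) (invmx A)) (invmx B)) (proj_perp w))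
  uK x'K (mxK_conj pK).
rewrite (contract_EAB _ Tcpd) // mulmxA -trmx_mul mulmxV // trmx1 mul1mx.
rewrite (contract_JGE_vector wxy) // subr0 vnormJ vnorm_perp2 -/S.
have -> : \sum_r u r 0 * x' r 0 * cinner p (proj_perp w *m col r Cm) = ((vnorm u ^+ 2)%:C)%C.
  rewrite sqr_vnorm rmorph_sum; apply: eq_bigr => r _ /=.
  rewrite cmod_sqr cinner_adj ctr_proj_perp proj_perp_perp2 -/(t r) !mxE conjCK.
  by rewrite -mulrA mulrC.
rewrite cmod_real ?sqr_ge0 // => h.
have wx0 : 0 < vnorm w * vnorm x' by rewrite mulr_gt0 ?vnorm_gt0.
have mu : m * (vnorm w * vnorm x') <= vnorm u.
  have m0 : 0 <= m by apply: le_bigmin => // i _; apply: sqrtr_ge0.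
  rewrite -(@ler_pXn2r _ 2) ?nnegrE ?mulr_ge0 ?vnorm_ge0 //.
  rewrite !exprMn [vnorm x' ^+ 2]sqr_vnorm [leRHS]sqr_vnorm !mulr_sumr.
  apply: ler_sum => r _; rewrite !mxE cmodJ cmodM exprMn mulrA mulrC.
  rewrite ler_wpM2l ?sqr_ge0 // -exprMn ler_pXn2r ?nnegrE ?mulr_ge0 ?vnorm_ge0 ?cmod_ge0 //.
  rewrite (cmod_cinner_perp2 w0) mulrC ler_wpM2l ?vnorm_ge0 //.
  by rewrite -(chordalE w0) // bigmin_chordal_le.
rewrite -(ler_pM2r wx0); apply: le_trans mu _.
have [u0|u0] := eqVneq (vnorm u) 0.
  by rewrite u0 mulr_ge0 ?spnorm_ge0 // ltW.
have u1 : 0 < vnorm u by rewrite lt_def u0 vnorm_ge0.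
rewrite -(ler_pM2r u1) -expr2; apply: le_trans h _.
by rewrite le_eqVlt; apply/orP; left; apply/eqP; ring.
Qed.

End JointEigenvalueBounds.

(** * Commuting families of matrices and generic vectors *)

Lemma common_eigenvector_in_eigenspace (F : numClosedFieldType) n (A : 'M[F]_n)
    (As : seq 'M[F]_n) (a : F) :
  eigenvalue A a -> {in As, forall B, comm_mx A B} ->
  {in As &, forall B B', comm_mx B B'} ->
  exists v : 'rV_n, [/\ v != 0, v *m A = a *: v & all (fun B => stablemx v B) As].
Proof.
move=> a_eigen A_comm As_comm.
(* Matrices commuting with [A] stabilise its eigenspace, so a common eigenvector is sought for their
   restrictions to it. *)
have [] := @common_eigenvector F _ [seq restrictmx (eigenspace A a) B | B <- As].
- by rewrite lt0n mxrank_eq0.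
- move=> _ _ /= /mapP /= [B B_in ->] /mapP /= [B' B'_in ->]; rewrite /comm_mx.
  rewrite -?conjmxM ?inE ?stablemx_row_base ?comm_mx_stable_eigenspace//;
  by [rewrite As_comm | apply: As_comm | apply: A_comm].
move=> v vN0 /allP /= vP; exists (v *m row_base (eigenspace A a)); split.
- by rewrite mulmx_free_eq0 ?row_base_free.
- by apply/eigenspaceP; rewrite mulmx_sub // eq_row_base.
apply/allP => B B_in; rewrite -stablemx_restrict ?vP //.
  by apply/mapP; exists B.
by rewrite comm_mx_stable_eigenspace //; exact: A_comm.
Qed.

(** A nonzero polynomial has fewer roots than its size, while the naturals below that size are
    distinct in characteristic zero. *)
Lemma poly_nat_nonroot (F : numFieldType) (p : {poly F}) :
  p != 0 -> exists t : nat, p.[t%:R] != 0.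
Proof.
move=> p0; apply: contrapT => h.
suff : (size [seq (i%:R : F) | i <- iota 0 (size p)] < size p)%N.
  by rewrite size_map size_iota ltnn.
apply: max_poly_roots p0 _ _; last first.
  by rewrite map_inj_uniq ?iota_uniq // => i j /eqP; rewrite eqr_nat => /eqP.
apply/allP => _ /mapP[i _ ->]; rewrite /root; apply/negPn/negP => pi.
by apply: h; exists i.
Qed.

(* The witness is taken on the moment curve (1, t, t^2, ...). *)
Lemma generic_vector (F : numFieldType) K n (H : 'M[F]_(K, n)) :
  exists t : nat, forall s, col s H != 0 ->
    (H^T *m (\col_k t%:R ^+ k : 'cV_K)) s 0 != 0.
Proof.
(* Pairing column s with the moment vector evaluates the polynomial [p s] at t; a nonroot of the
   product over nonzero columns serves all of them at once. *)
pose p s := rVpoly (col s H)^T.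
have p0 : \prod_(s | col s H != 0) p s != 0.
  apply/prodf_neq0 => s; apply: contra_neq => ps0; apply: trmx_inj.
  by rewrite -[LHS]rVpolyK -/(p s) ps0 linear0 trmx0.
have [t] := poly_nat_nonroot p0; rewrite horner_prod => /prodf_neq0 ht.
exists t => s /ht; apply: contra_neq; rewrite mxE => <-.
rewrite (horner_coef_wide _ (size_poly _ _)).
by apply: eq_bigr => k _; rewrite coef_rVpoly_ord !mxE.
Qed.

(** After simultaneous triangularisation the determinant is the product of the diagonal entries,
    each linear in g. *)
Lemma det_comm_linear_forms (F : numClosedFieldType) n K (N : 'I_K -> 'M[F]_n) :
  (forall k l, comm_mx (N k) (N l)) ->
  exists D : 'M[F]_(K, n), forall g : 'cV_K,
    \det (\sum_l g l 0 *: N l) = \prod_r \sum_l D l r * g l 0.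
Proof.
move=> Ncomm.
have [P Pu Ptrig] : exists2 P : 'M[F]_n, P \in unitmx &
    forall l, is_trig_mx (P *m N l *m invmx P).
  have [] := @cotrigonalization F n [seq N l | l <- enum 'I_K].
    by move=> _ _ /mapP[k _ ->] /mapP[l _ ->].
  move=> P /unitarymx_unit Pu /allP h; exists P => // l.
  rewrite -conjumx //; apply: h; apply: map_f; exact: mem_enum.
pose D l := P *m N l *m invmx P.
exists (\matrix_(l, r) D l r r) => g.
have -> : \sum_l g l 0 *: N l = invmx P *m (\sum_l g l 0 *: D l) *m P.
  rewrite mulmx_sumr mulmx_suml; apply: eq_bigr => l _.
  by rewrite -scalemxAr -scalemxAl /D mulmxA mulmxKV // mulKmx.
rewrite !det_mulmx det_inv mulrAC mulVf ?mul1r -?unitfE // det_trig.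
  by apply: eq_bigr => r _; rewrite summxE; apply: eq_bigr => l _; rewrite !mxE mulrC.
apply/is_trig_mxP => i j ij; rewrite summxE big1 // => l _.
by rewrite mxE; have /is_trig_mxP/(_ i j ij) -> := Ptrig l; rewrite mulr0.
Qed.

Lemma det_eq0_of_kernel (F : fieldType) n (A : 'M[F]_n) (x : 'cV[F]_n) :
  x != 0 -> A *m x = 0 -> \det A = 0.
Proof.
move=> x0 Ax; apply/eqP; apply: contraNT x0; rewrite -unitfE -unitmxE => Au.
by rewrite -[x](mulKmx Au) Ax mulmx0.
Qed.

(** The singular mix has eigenvalue 0 and commutes with the family, so a common eigenvector exists
    in its kernel; transposes appear because eigenvectors are rows. *)
Lemma comm_joint_kernel_eigenvector (F : numClosedFieldType) n K
    (N : 'I_K -> 'M[F]_n) (z : 'cV[F]_K) :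
  (forall k l, comm_mx (N k) (N l)) -> \det (\sum_l z l 0 *: N l) = 0 ->
  exists (x : 'cV[F]_n) (mu : 'cV[F]_K),
    [/\ x != 0, forall l, N l *m x = mu l 0 *: x & \sum_l mu l 0 * z l 0 = 0].
Proof.
move=> Ncomm Nz0; pose A := (\sum_l z l 0 *: N l)^T.
have A0 : eigenvalue A 0.
  have /eqP/det0P[v v0 vA] : \det A = 0 by rewrite det_tr.
  by apply/eigenvalueP; exists v; rewrite ?scale0r.
have commA (k : 'I_K) : comm_mx A (N k)^T.
  rewrite /comm_mx /A -!trmx_mul mulmx_suml mulmx_sumr; congr (_ ^T).
  by apply: eq_bigr => l _; rewrite -scalemxAl -scalemxAr Ncomm.
have [] := @common_eigenvector_in_eigenspace F n A [seq (N l)^T | l <- enum 'I_K] 0 A0.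
- by move=> _ /mapP[k _ ->]; apply: commA.
- by move=> _ _ /mapP[k _ ->] /mapP[l _ ->]; rewrite /comm_mx -!trmx_mul Ncomm.
move=> v [v0 vA /allP vst].
have eig l : exists c, v *m (N l)^T == c *: v.
  have /vst/eigenvectorP[c] : (N l)^T \in [seq (N l)^T | l <- enum 'I_K].
    by apply: map_f; exact: mem_enum.
  by move=> /eigenspaceP/eqP ?; exists c.
pose mu : 'cV[F]_K := \col_l xchoose (eig l).
have Nx l : N l *m v^T = mu l 0 *: v^T.
  rewrite mxE; have /eqP/(congr1 trmx) := xchooseP (eig l).
  by rewrite trmx_mul trmxK linearZ.
have x0 : v^T != 0 by rewrite -trmx0 (inj_eq trmx_inj).
exists v^T, mu; split=> //.
have : (\sum_l z l 0 *: N l) *m v^T = (\sum_l mu l 0 * z l 0) *: v^T.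
  rewrite mulmx_suml scaler_suml; apply: eq_bigr => l _.
  by rewrite -scalemxAl Nx scalerA mulrC.
have -> : (\sum_l z l 0 *: N l) *m v^T = 0.
  by rewrite -[X in X *m _]trmxK -trmx_mul vA scale0r trmx0.
by move=> /esym/eqP; rewrite scaler_eq0 (negbTE x0) orbF => /eqP.
Qed.

(** * Spectrum of a tensor whose normalised slices commute *)

Section Spectrum.
Variable R : realType.
Local Notation C := (R[i]).
Variables (b : bool) (n K : nat) (W : tensor R n n K).

Lemma slice_mixB (X : tensor R n n K) g h :
  slice_mix X (g - h) = slice_mix X g - slice_mix X h.
Proof. by rewrite /slice_mix -sumrB; apply: eq_bigr => l _; rewrite !mxE scalerBl. Qed.

Lemma slice_mixZ (X : tensor R n n K) a g :
  slice_mix X (a *: g) = a *: slice_mix X g.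
Proof. by rewrite /slice_mix scaler_sumr; apply: eq_bigr => l _; rewrite !mxE scalerA. Qed.

Lemma slice_mix_delta (X : tensor R n n K) l : slice_mix X (delta_mx l 0) = slice X l.
Proof.
rewrite /slice_mix (bigD1 l) //= big1 ?addr0; first by rewrite mxE !eqxx scale1r.
by move=> i /negbTE il; rewrite mxE il scale0r.
Qed.

Lemma mxK_slice_mix g : (forall l, mxK b (slice W l)) -> mxK b g -> mxK b (slice_mix W g).
Proof.
move=> WK gK; apply/mxKP => b1; rewrite /slice_mix raddf_sum.
apply: eq_bigr => l _ /=; rewrite map_mxZ /=; congr (_ *: _).
  exact: ((inKP b _).1 (gK l 0)).
exact: ((mxKP b _).1 (WK l)).
Qed.

(* The [N l] are the slices of a tensor equivalent to W whose [g0]-mix is the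
   identity. *)
Variable g0 : 'cV[C]_K.
Local Notation M := (slice_mix W g0).
Local Notation N := (fun l => invmx M *m slice W l).
Hypotheses (g0K : mxK b g0) (Mu : M \in unitmx).
Hypothesis WK : forall l, mxK b (slice W l).
Hypothesis Ncomm : forall k l, comm_mx (N k) (N l).
(** Here [d] ranges over the generalized eigenvalues of the pencil (W_l, M); for K = R they must be
    real for eigenvalue vectors to have entries in K. *)
Hypothesis Wreal : forall l d,
  pX W (delta_mx l 0 - d *: g0) = 0 -> inK b d.

Lemma slice_mixE g : slice_mix W g = M *m \sum_l g l 0 *: N l.
Proof.
by rewrite mulmx_sumr; apply: eq_bigr => l _; rewrite -scalemxAr mulKVmx.
Qed.

Lemma sum_slices_eq1 : \sum_l g0 l 0 *: N l = 1%:M.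
Proof.
by rewrite -[LHS](mulKmx Mu) -slice_mixE mulVmx.
Qed.

(** The linear forms from triangularisation are scaled to take the value 1 at [g0]; their
    coefficients are then generalized eigenvalues of the slices, hence lie in K. *)
Lemma spectrum_exists : exists L : 'M[C]_(K, n), is_spectrum b W L.
Proof.
have [D DE] := det_comm_linear_forms Ncomm.
have pE g : pX W g = \det M * \prod_r \sum_l D l r * g l 0.
  by rewrite /pX slice_mixE det_mulmx DE.
have D1 r : \sum_k D k r * g0 k 0 != 0.
  have := DE g0; rewrite sum_slices_eq1 det1 => /esym h.
  apply/negP => /eqP h0; move: h; rewrite (bigD1 r) //= h0 mul0r => /eqP.
  by rewrite eq_sym oner_eq0.
pose a r := \sum_k D k r * g0 k 0.
have DK l r : inK b (D l r / a r).
  apply: (Wreal (l := l)); rewrite pE (bigD1 r) //= (_ : \sum_k _ = 0) ?mul0r ?mulr0 //.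
  transitivity (\sum_k D k r * (delta_mx l 0 : 'cV[C]_K) k 0
                 - D l r / a r * a r).
    rewrite /a mulr_sumr -sumrB; apply: eq_bigr => k _.
    by rewrite [X in _ * X]mxE [X in _ + X]mxE [X in - X]mxE; ring.
  rewrite divfK ?D1 // (bigD1 l) //= big1 ?addr0; first by rewrite mxE !eqxx mulr1 subrr.
  by move=> k /negbTE kl; rewrite mxE kl mulr0.
(* The leftover factor det M is absorbed into the form of index 0. *)
exists (\matrix_(k, r) ((if (r == 0 :> nat)%N then \det M else 1) * (D k r / a r))); split.
  move=> k r; rewrite mxE; apply/inKP => b1; rewrite rmorphM /=.
  rewrite ((inKP b _).1 (DK k r)) //; congr (_ * _); case: ifP => _; last exact: conjC1.
  have /mxKP/(_ b1) MK := mxK_slice_mix WK g0K.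
  by rewrite -det_map_mx MK.
have prod_a : \prod_r a r = 1 by rewrite -DE sum_slices_eq1 det1.
move=> g _; rewrite pE.
under [RHS]eq_bigr => r _.
  under eq_bigr => k _ do rewrite mxE -!mulrA [(a r)^-1 * _]mulrC [D k r * _]mulrA.
  rewrite -mulr_sumr -mulr_suml; over.
rewrite !big_split /= prodfV prod_a invr1 mulr1; congr (_ * _).
(* For n = 0 no form can carry det M, but that determinant is 1. *)
case: (posnP n) => [n0|n0].
  rewrite big1; last by move=> r; have := ltn_ord r; rewrite [X in (_ < X)%N]n0.
  by move: (M); rewrite n0 => M'; rewrite det_mx00.
rewrite (bigD1 (Ordinal n0)) //= big1 ?mulr1 // => r r0.
by rewrite -[0%N]/(val (Ordinal n0)) val_eqE (negbTE r0).
Qed.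


Lemma joint_eigenvector z : pX W z = 0 -> exists (x : 'cV[C]_n) (mu : 'cV[C]_K),
  [/\ x != 0, mxK b mu, forall l, slice W l *m x = mu l 0 *: (M *m x) &
      \sum_l mu l 0 * z l 0 = 0].
Proof.
move=> pz0.
have Nz0 : \det (\sum_l z l 0 *: N l) = 0.
  move: pz0; rewrite /pX slice_mixE det_mulmx => /eqP.
  by rewrite mulf_eq0 -[X in X || _]negbK -unitfE -unitmxE Mu => /eqP.
have [x [mu [x0 Nx muz]]] := comm_joint_kernel_eigenvector Ncomm Nz0.
have Wx l : slice W l *m x = mu l 0 *: (M *m x).
  by rewrite scalemxAr -Nx -mulmxA mulKVmx.
exists x, mu; split=> // l j; rewrite ord1; apply: (Wreal (l := l)).
apply: (det_eq0_of_kernel x0).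
by rewrite slice_mixB slice_mix_delta slice_mixZ mulmxBl Wx -scalemxAl subrr.
Qed.

(* A joint eigenvector in the kernel of a generic mix orthogonal to the i-th
   column of L has its eigenvalue proportional to some column of L, hence,
   by genericity, to the i-th one. *)
Lemma spectrum_JGE_complex (L : 'M[C]_(K, n)) (i : 'I_n) : is_spectrum b W L ->
  (L^T *m g0) i 0 != 0 /\ exists2 x : 'cV[C]_n, x != 0 &
    forall l, slice W l *m x = (L l i / (L^T *m g0) i 0) *: (M *m x).
Proof.
move=> [LK pL].
have {}pL g : mxK b g -> pX W g = \prod_s (L^T *m g) s 0.
  move=> /pL ->; apply: eq_bigr => s _; rewrite mxE.
  by apply: eq_bigr => k _; rewrite mxE.
pose a s := (L^T *m g0) s 0; rewrite -/(a i).
have a0 s : a s != 0.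
  have : pX W g0 != 0 by rewrite /pX -unitfE -unitmxE.
  by rewrite pL // => /prodf_neq0 /(_ s isT).
have aK s : inK b (a s) by apply: mxKM => //; apply: mxK_tr.
(* The factorisation of [pX] is available only on vectors over K; points of the moment curve
   qualify, having natural entries. *)
have tK t : mxK b (\col_k (t%:R : C) ^+ k : 'cV_K).
  by move=> k j; rewrite mxE; apply/inKP => _; rewrite rmorphXn /= conjC_nat.
split=> //.
(* Column s of [H] vanishes exactly when columns s and i of L agree once each is scaled to pair to 1
   with [g0]. *)
pose H : 'M[C]_(K, n) := \matrix_(k, s) (L k s - a s / a i * L k i).
have [t1 ht1] := generic_vector H.
pose g1 : 'cV[C]_K := \col_k (t1%:R : C) ^+ k; rewrite -/g1 in ht1.
(* [g1] is shifted along [g0] until form i vanishes; form s then takes at [z] the value of column s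
   of [H] at [g1]. *)
pose z := g1 - ((L^T *m g1) i 0 / a i) *: g0.
have LgK (g : 'cV[C]_K) s : mxK b g -> inK b ((L^T *m g) s 0).
  by move=> gK; apply: mxKM gK _ _; apply: mxK_tr.
have zK : mxK b z.
  apply: mxKB; first exact: tK.
  apply: mxKZ g0K; apply/inKP => b1; rewrite rmorphM fmorphV /=.
  by rewrite ((inKP b _).1 (aK i)) // ((inKP b _).1 (LgK g1 i (tK t1))).
have Lz s : (L^T *m z) s 0 = (H^T *m g1) s 0.
  have -> : H^T *m g1 = L^T *m g1 - \col_s (a s / a i * (L^T *m g1) i 0).
    apply/matrixP => r j; rewrite !mxE mulr_sumr -sumrB ord1.
    by apply: eq_bigr => k _; rewrite !mxE mulrBl mulrA.
  rewrite /z mulmxBr -scalemxAr -/(a s).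
  rewrite [LHS]mxE [RHS]mxE; congr (_ + _); rewrite [LHS]mxE [RHS]mxE; congr (- _).
  by rewrite [LHS]mxE [RHS]mxE -/(a s) mulrC mulrA mulrAC.
have pz : pX W z = 0.
  rewrite pL // (bigD1 i) //= Lz mxE big1 ?mul0r // => k _.
  by rewrite !mxE divff // mul1r subrr mul0r.
have [x [mu [x0 muK Wx muz]]] := joint_eigenvector pz.
have mug g : slice_mix W g *m x = (\sum_l mu l 0 * g l 0) *: (M *m x).
  rewrite mulmx_suml scaler_suml; apply: eq_bigr => l _.
  by rewrite -scalemxAl Wx scalerA mulrC.
have Mx0 : M *m x != 0.
  by apply: contra_neq x0 => h; rewrite -[x](mulKmx Mu) h mulmx0.
have mug0 : \sum_l mu l 0 * g0 l 0 = 1.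
  have /eqP := mug g0; rewrite -[X in X == _]scale1r -subr_eq0 -scalerBl scaler_eq0.
  by rewrite (negbTE Mx0) orbF subr_eq0 => /eqP.
(* Otherwise a generic [g2], shifted along [g0], gives a mix that kills x although no linear form
   vanishes there. *)
have [s muE] : exists s, forall k, mu k 0 = L k s / a s.
  apply: contrapT => h.
  pose G : 'M[C]_(K, n) := \matrix_(k, s) (L k s - a s * mu k 0).
  have [t2 ht2] := generic_vector G.
  pose g2 : 'cV[C]_K := \col_k (t2%:R : C) ^+ k; rewrite -/g2 in ht2.
  pose c := \sum_l mu l 0 * g2 l 0.
  have cK : inK b c.
    have -> : c = (mu^T *m g2) 0 0.
      by rewrite [RHS]mxE; apply: eq_bigr => k _; rewrite [mu^T _ _]mxE.
    by apply: mxKM (tK t2) _ _; apply: mxK_tr.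
  pose g3 := g2 - c *: g0.
  have g3K : mxK b g3 by apply: mxKB; [exact: tK | exact: mxKZ].
  have : pX W g3 = 0.
    apply: (det_eq0_of_kernel x0); rewrite slice_mixB slice_mixZ mulmxBl -scalemxAl.
    by rewrite mug -/c subrr.
  rewrite pL // => /eqP; apply/negP; apply/prodf_neq0 => s _.
  have -> : (L^T *m g3) s 0 = (G^T *m g2) s 0.
    rewrite /g3 mulmxBr -scalemxAr [LHS]mxE [X in _ + X]mxE [X in - X]mxE -/(a s).
    rewrite [RHS]mxE [X in X - _]mxE /c mulr_suml -sumrB.
    by apply: eq_bigr => k _; rewrite !mxE; ring.
  apply: ht2; apply/negP => /eqP Gs0; apply: h; exists s => k.
  have /matrixP/(_ k 0) := Gs0; rewrite !mxE => /eqP; rewrite subr_eq0 => /eqP ->.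
  by rewrite mulrC mulKf.
(* Form s at [z] is a multiple of the pairing of mu with [z], which is zero; genericity of [g1] then
   forces column s of [H] to vanish. *)
have hs0 : col s H = 0.
  apply/eqP; apply: contraT => /ht1; rewrite -Lz.
  have -> : (L^T *m z) s 0 = a s * \sum_l mu l 0 * z l 0.
    rewrite mxE mulr_sumr; apply: eq_bigr => k _.
    by rewrite muE mxE mulrA mulrCA divff ?mulr1.
  by rewrite muz mulr0 eqxx.
exists x => // l; rewrite Wx muE; congr (_ *: _).
have /matrixP/(_ l 0) := hs0; rewrite !mxE => /eqP; rewrite subr_eq0 => /eqP ->.
by rewrite mulrC mulrA mulrA mulVf // mul1r mulrC.
Qed.

(** For K = R the eigenvector x found so far may be complex. All other data are real, so conj(x)
    satisfies the same equations, and x + conj(x) is a real solution; if that sum is zero, i x is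
    one. *)
Lemma spectrum_JGE (L : 'M[C]_(K, n)) (i : 'I_n) : is_spectrum b W L ->
  JGE_value b W (col i L).
Proof.
move=> Lsp; have [ai0 [x x0 Wx]] := spectrum_JGE_complex i Lsp.
have [LK _] := Lsp; set a := (L^T *m g0) i 0 in ai0 Wx.
have aK : inK b a by apply: mxKM => //; apply: mxK_tr.
have MK := mxK_slice_mix WK g0K.
split; first exact: mxK_col.
  apply: contra_neq ai0 => L0; rewrite /a mxE big1 // => k _.
  by have /matrixP/(_ k 0) := L0; rewrite !mxE => ->; rewrite mul0r.
suff [x' [x'0 x'K Wx']] : exists x' : 'cV[C]_n, [/\ x' != 0, mxK b x' &
    forall l, slice W l *m x' = (L l i / a) *: (M *m x')].
  exists x', (a^-1 *: (M *m x')); split => //.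
  - apply: mxKZ; last exact: mxKM.
    by apply/inKP => b1; rewrite fmorphV /= ((inKP b _).1 aK).
  - rewrite scaler_eq0 invr_eq0 (negbTE ai0) /=; apply: contra_neq x'0 => h.
    by rewrite -[x'](mulKmx Mu) h mulmx0.
  - by move=> l; rewrite Wx' scalerA mxE.
case: (boolP b) => [b1|b0]; last by exists x; split=> // l j; rewrite /inK (negbTE b0).
pose J := map_mx (@Num.conj C).
have Wxc l : slice W l *m J _ _ x = (L l i / a) *: (M *m J _ _ x).
  have /(congr1 (J _ _)) := Wx l; rewrite /J map_mxM map_mxZ map_mxM /=.
  rewrite ((mxKP b _).1 (WK l)) // ((mxKP b _).1 MK) //.
  by rewrite rmorphM fmorphV /= ((inKP b _).1 (LK l i)) // ((inKP b _).1 aK).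
have [xJ0|xJ0] := eqVneq (x + J _ _ x) 0; last first.
  exists (x + J _ _ x); split=> //.
    apply/mxKP => _; rewrite map_mxD addrC; congr (_ + _).
    by rewrite /J -map_mx_comp map_mx_id //; exact: conjCK.
  by move=> l; rewrite !mulmxDr Wx Wxc scalerDr.
exists ('i *: x); split.
- by rewrite scaler_eq0 (negbTE (neq0Ci _)).
- apply/mxKP => _; rewrite map_mxZ /= conjCi -/(J _ _ x).
  by rewrite scaleNr -scalerN; congr (_ *: _); apply/eqP; rewrite eq_sym -addr_eq0 xJ0.
- by move=> l; rewrite -!scalemxAr Wx !scalerA [in LHS]mulrC.
Qed.


End Spectrum.

(** The adjugate replaces the inverse because it is polynomial in the entries, hence continuous;
    [M *m \adj M] is the scalar det M, which leaves only the commuting [G1] and [G2]. *)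
Lemma adj_sandwich_comm (F : comNzRingType) n (M G1 G2 : 'M[F]_n) :
  G1 *m G2 = G2 *m G1 ->
  G1 *m M *m \adj M *m (G2 *m M) = G2 *m M *m \adj M *m (G1 *m M).
Proof.
move=> GC; have h (G H : 'M[F]_n) : G *m M *m \adj M *m (H *m M) = \det M *: (G *m H *m M).
  by rewrite -(mulmxA G) mul_mx_adj mul_mx_scalar -scalemxAl mulmxA.
by rewrite !h GC.
Qed.

(** * Closed conditions inherited by tensors of bounded border rank *)

Section BorderRank.
Variable R : realType.
Local Notation C := (R[i]).

Section Continuity.
Variables (I J K : nat) (X : tensor R I J K).
Implicit Types f h : tensor R I J K -> C.

(** Continuity at the fixed tensor [X], for the entrywise distance used in [bKrank_le]. *)
Definition tcontinuous f := forall eps : R, 0 < eps ->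
  exists2 delta : R, 0 < delta & forall Y : tensor R I J K,
    (forall i j k, cmod (X i j k - Y i j k) < delta) -> cmod (f X - f Y) < eps.

Lemma tcont_cst c : tcontinuous (fun=> c).
Proof. by move=> eps e0; exists 1 => // Y _; rewrite subrr cmod0. Qed.

Lemma tcont_coord i j k : tcontinuous (fun Y => Y i j k).
Proof. by move=> eps e0; exists eps. Qed.

Lemma tcontD f h : tcontinuous f -> tcontinuous h -> tcontinuous (fun Y => f Y + h Y).
Proof.
move=> fc hc eps e0; have e20 : 0 < eps / 2 by rewrite divr_gt0.
have [d1 d10 fY] := fc _ e20; have [d2 d20 hY] := hc _ e20.
exists (Num.min d1 d2); first by rewrite lt_min d10.
move=> Y XY; have -> : f X + h X - (f Y + h Y) = (f X - f Y) + (h X - h Y) by ring.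
apply: le_lt_trans (cmodD _ _) _; rewrite [eps]splitr.
by apply: ltrD; [apply: fY|apply: hY] => i j k; have := XY i j k; rewrite lt_min => /andP[].
Qed.

Lemma tcontM f h : tcontinuous f -> tcontinuous h -> tcontinuous (fun Y => f Y * h Y).
Proof.
move=> fc hc eps e0.
have f1 : 0 < cmod (f X) + 1 by rewrite ltr_wpDl ?cmod_ge0.
have h1 : 0 < cmod (h X) + 1 by rewrite ltr_wpDl ?cmod_ge0.
have e1 : 0 < eps / 2 / (cmod (h X) + 1) by rewrite !divr_gt0.
(* The bound 1 keeps |h Y| below |h X| + 1. *)
have e2 : 0 < Num.min 1 (eps / 2 / (cmod (f X) + 1)) by rewrite lt_min ltr01 !divr_gt0.
have [d1 d10 fY] := fc _ e1; have [d2 d20 hY] := hc _ e2.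
exists (Num.min d1 d2); first by rewrite lt_min d10.
move=> Y XY.
have {}fY : cmod (f X - f Y) < eps / 2 / (cmod (h X) + 1).
  by apply: fY => i j k; have := XY i j k; rewrite lt_min => /andP[].
have : cmod (h X - h Y) < Num.min 1 (eps / 2 / (cmod (f X) + 1)).
  by apply: hY => i j k; have := XY i j k; rewrite lt_min => /andP[].
rewrite lt_min => /andP[hY1 hY2].
have hYle : cmod (h Y) <= cmod (h X) + 1.
  have -> : h Y = h X + - (h X - h Y) by ring.
  by apply: le_trans (cmodD _ _) _; rewrite cmodN lerD2l ltW.
have -> : f X * h X - f Y * h Y = (f X - f Y) * h Y + f X * (h X - h Y) by ring.
apply: le_lt_trans (cmodD _ _) _; rewrite !cmodM [eps]splitr; apply: ltr_leD.
  apply: le_lt_trans (_ : cmod (f X - f Y) * (cmod (h X) + 1) < _).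
    by rewrite ler_wpM2l ?cmod_ge0.
  by rewrite -ltr_pdivlMr.
apply: le_trans (_ : (cmod (f X) + 1) * cmod (h X - h Y) <= _).
  by rewrite ler_wpM2r ?cmod_ge0 // lerDl.
by rewrite mulrC -ler_pdivlMr // ltW.
Qed.

Lemma tcontB f h : tcontinuous f -> tcontinuous h -> tcontinuous (fun Y => f Y - h Y).
Proof.
move=> fc hc; apply: tcontD => // eps e0; have [d d0 hY] := hc _ e0.
by exists d => // Y /hY; rewrite -opprD cmodN.
Qed.

Lemma tcont_sum (T : Type) (s : seq T) (P : pred T) (F : T -> tensor R I J K -> C) :
  (forall t, tcontinuous (F t)) -> tcontinuous (fun Y => \sum_(t <- s | P t) F t Y).
Proof.
move=> Fc; elim: s => [|t s IHs].
  by move=> eps e0; exists 1 => // Y _; rewrite !big_nil subrr cmod0.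
case Pt: (P t).
  by move=> eps /(tcontD (Fc t) IHs)[d d0 h]; exists d => // Y /h; rewrite !big_cons Pt.
by move=> eps /IHs[d d0 h]; exists d => // Y /h; rewrite !big_cons Pt.
Qed.

Lemma tcont_prod (T : Type) (s : seq T) (P : pred T) (F : T -> tensor R I J K -> C) :
  (forall t, tcontinuous (F t)) -> tcontinuous (fun Y => \prod_(t <- s | P t) F t Y).
Proof.
move=> Fc; elim: s => [|t s IHs].
  by move=> eps e0; exists 1 => // Y _; rewrite !big_nil subrr cmod0.
case Pt: (P t).
  by move=> eps /(tcontM (Fc t) IHs)[d d0 h]; exists d => // Y /h; rewrite !big_cons Pt.
by move=> eps /IHs[d d0 h]; exists d => // Y /h; rewrite !big_cons Pt.
Qed.

Definition tcontinuous_mx m n (F : tensor R I J K -> 'M[C]_(m, n)) :=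
  forall i j, tcontinuous (fun Y => F Y i j).

Lemma eq_tcontinuous f h : f =1 h -> tcontinuous f -> tcontinuous h.
Proof. by move=> fh fc eps /fc[d d0 fY]; exists d => // Y /fY; rewrite !fh. Qed.

Lemma tcont_det n (F : tensor R I J K -> 'M[C]_n) :
  tcontinuous_mx F -> tcontinuous (fun Y => \det (F Y)).
Proof.
by move=> Fc; apply: tcont_sum => s; apply: tcontM; [exact: tcont_cst | apply: tcont_prod].
Qed.

Lemma tcont_adj n (F : tensor R I J K -> 'M[C]_n) :
  tcontinuous_mx F -> tcontinuous_mx (fun Y => \adj (F Y)).
Proof.
move=> Fc i j; apply: (@eq_tcontinuous (fun Y => cofactor (F Y) j i)).
  by move=> Y; rewrite mxE.
apply: tcontM; [exact: tcont_cst | apply: tcont_det => k l].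
by apply: eq_tcontinuous (Fc _ _) => Y; rewrite !mxE.
Qed.

Lemma tcont_mulmx m n p (F : tensor R I J K -> 'M[C]_(m, n))
    (G : tensor R I J K -> 'M[C]_(n, p)) :
  tcontinuous_mx F -> tcontinuous_mx G -> tcontinuous_mx (fun Y => F Y *m G Y).
Proof.
move=> Fc Gc i j; apply: (@eq_tcontinuous (fun Y => \sum_k F Y i k * G Y k j)).
  by move=> Y; rewrite mxE.
by apply: tcont_sum => k; apply: tcontM.
Qed.

(** A non-strict inequality between continuous functions passes to the limit. *)
Lemma bKrank_le_bound b n (c : R) f h : bKrank_le b X n -> 0 <= c ->
  tcontinuous f -> tcontinuous h ->
  (forall Y, Krank_le b Y n -> c * cmod (h Y) <= cmod (f Y)) ->
  c * cmod (h X) <= cmod (f X).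
Proof.
move=> Xn c0 fc hc fh; rewrite leNgt; apply/negP => lt_fh.
(* Errors of [e] in both functions shift the comparison by at most e (c + 1), which is exactly the
   assumed gap. *)
pose e := (c * cmod (h X) - cmod (f X)) / (c + 1).
have c1 : 0 < c + 1 by rewrite ltr_wpDl.
have e0 : 0 < e by rewrite divr_gt0 // subr_gt0.
have [d1 d10 fY] := fc _ e0; have [d2 d20 hY] := hc _ e0.
have d0 : 0 < Num.min d1 d2 by rewrite lt_min d10.
have [Y [Yn XY]] := Xn _ d0.
have {}fY : cmod (f X - f Y) < e.
  by apply: fY => i j k; have := XY i j k; rewrite lt_min => /andP[].
have {}hY : cmod (h X - h Y) < e.
  by apply: hY => i j k; have := XY i j k; rewrite lt_min => /andP[].
have fYle : cmod (f Y) <= cmod (f X) + cmod (f X - f Y).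
  by rewrite -[in leRHS](cmodN (f X - f Y)); apply: le_trans (cmodD _ _); rewrite opprB addrC subrK.
have hXle : cmod (h X) <= cmod (h Y) + cmod (h X - h Y).
  by apply: le_trans (cmodD _ _); rewrite addrC subrK.
have : c * cmod (h X) < cmod (f X) + e * (c + 1).
  apply: le_lt_trans (_ : c * cmod (h Y) + c * e < _).
    by rewrite -mulrDr ler_wpM2l // (le_trans hXle) // lerD2l ltW.
  have := fh Y Yn; nra.
by rewrite divfK ?gt_eqF // addrC subrK ltxx.
Qed.

Lemma bKrank_le_eq0 b n f : bKrank_le b X n -> tcontinuous f ->
  (forall Y, Krank_le b Y n -> f Y = 0) -> f X = 0.
Proof.
move=> Xn fc f0; apply/eqP; rewrite -cmod_eq0 eq_le cmod_ge0 andbT.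
have := @bKrank_le_bound b n 1 (fun=> 0) f Xn ler01 (tcont_cst 0) fc.
by rewrite cmod0 mul1r; apply => Y /f0 ->; rewrite cmod0 mulr0.
Qed.

End Continuity.

Section SliceMix.
Variables (b : bool) (n K : nat).
Implicit Types X Y : tensor R n n K.

Lemma slice_mix_cpd Y (A B : 'M[C]_n) (Cm : 'M[C]_(K, n)) g : is_cpd b Y A B Cm ->
  slice_mix Y g = A *m diag_mx (g^T *m Cm) *m B^T.
Proof.
case=> _ _ _ YE; apply/matrixP => i j; rewrite summxE mxE.
under eq_bigr => l _ do rewrite !mxE YE /cpd mulr_sumr.
rewrite exchange_big /=; apply: eq_bigr => r _.
rewrite mul_mx_diag !mxE mulr_sumr mulr_suml; apply: eq_bigr => l _.
by rewrite !mxE; ring.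
Qed.

Lemma pX_cpd Y (A B : 'M[C]_n) (Cm : 'M[C]_(K, n)) g : is_cpd b Y A B Cm ->
  pX Y g = \det A * \det B * \prod_r (g^T *m Cm) 0 r.
Proof.
by move=> Yc; rewrite /pX (slice_mix_cpd g Yc) !det_mulmx det_tr det_diag mulrAC.
Qed.

Lemma tcont_slice_mix X g : tcontinuous_mx X (fun Y => slice_mix Y g).
Proof.
move=> i j; apply: (@eq_tcontinuous _ _ _ X (fun Y => \sum_l g l 0 * Y i j l)).
  by move=> Y; rewrite summxE; apply: eq_bigr => l _; rewrite !mxE.
by apply: tcont_sum => l; apply: tcontM; [exact: tcont_cst | exact: tcont_coord].
Qed.

(** A nonzero determinant at [g0] makes A invertible, and every mix is the [g0]-mix multiplied on
    the left by a matrix A D A^-1 with D diagonal; such matrices commute. *)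
Lemma Krank_le_slices_comm Y g0 g1 g2 : Krank_le b Y n -> pX Y g0 != 0 ->
  slice_mix Y g1 *m \adj (slice_mix Y g0) *m slice_mix Y g2 =
  slice_mix Y g2 *m \adj (slice_mix Y g0) *m slice_mix Y g1.
Proof.
move=> [A [B [Cm Yc]]] p0.
have := p0; rewrite (pX_cpd g0 Yc) !mulf_eq0 !negb_or => /andP[/andP[dA dB] /prodf_neq0 dC].
have Au : A \in unitmx by rewrite unitmxE unitfE.
pose e (g : 'cV[C]_K) : 'rV[C]_n := \row_r ((g^T *m Cm) 0 r / (g0^T *m Cm) 0 r).
pose G g := A *m diag_mx (e g) *m invmx A.
have conjA (D1 D2 B' : 'M[C]_n) :
    A *m D1 *m invmx A *m (A *m D2 *m B') = A *m (D1 *m D2) *m B'.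
  by rewrite !mulmxA mulmxKV.
have YE g : slice_mix Y g = G g *m slice_mix Y g0.
  rewrite (slice_mix_cpd g Yc) (slice_mix_cpd g0 Yc) conjA mulmx_diag.
  congr (A *m diag_mx _ *m _); apply/rowP => r.
  by rewrite [RHS]mxE [X in X * _]mxE divfK // dC.
have GC : G g1 *m G g2 = G g2 *m G g1.
  by etransitivity; [exact: conjA | rewrite diag_mxC; exact: esym (conjA _ _ _)].
rewrite (YE g1) (YE g2); exact: adj_sandwich_comm.
Qed.

Lemma bKrank_le_slices_comm X g0 g1 g2 : bKrank_le b X n -> pX X g0 != 0 ->
  slice_mix X g1 *m invmx (slice_mix X g0) *m slice_mix X g2 =
  slice_mix X g2 *m invmx (slice_mix X g0) *m slice_mix X g1.
Proof.
move=> Xn p0; have Mu : slice_mix X g0 \in unitmx by rewrite unitmxE unitfE.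
have adjE : \adj (slice_mix X g0) = pX X g0 *: invmx (slice_mix X g0).
  by rewrite /invmx Mu scalerA divff // scale1r.
apply/matrixP => i j; apply/eqP; rewrite -subr_eq0; apply/eqP.
(* The factor [pX Y g0] makes [f] vanish also at those Y whose [g0]-mix is singular. *)
pose f Y := pX Y g0 *
  ((slice_mix Y g1 *m \adj (slice_mix Y g0) *m slice_mix Y g2) i j
   - (slice_mix Y g2 *m \adj (slice_mix Y g0) *m slice_mix Y g1) i j).
have sc g : tcontinuous_mx X (fun Y => slice_mix Y g) := tcont_slice_mix X g.
have fX : f X = 0.
  apply: (bKrank_le_eq0 Xn).
    apply: tcontM; first exact: tcont_det.
    by apply: tcontB; apply: tcont_mulmx => //; apply: tcont_mulmx => //; apply: tcont_adj.
  move=> Y Yn; rewrite /f; have [->|p0'] := eqVneq (pX Y g0) 0; first by rewrite mul0r.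
  by rewrite (Krank_le_slices_comm _ _ Yn p0') subrr mulr0.
move: fX; rewrite /f adjE -!scalemxAr -!scalemxAl ![(_ *: _ : 'M_n) i j]mxE -mulrBr.
by move/eqP; rewrite !mulf_eq0 (negbTE p0) /= => /eqP.
Qed.

Lemma cmod_ge_Im (z : C) : `|complex.Im z| <= cmod z.
Proof.
case: z => x y; rewrite /cmod /= -sqrtr_sqr; apply: ler_wsqrtr.
by rewrite lerDr sqr_ge0.
Qed.

(* If d is not real, the factors a - d * a0 of the determinant of a real
   rank-n tensor are bounded below by |Im d| |a0|, and this survives in the limit. *)
Lemma bKrank_le_real_eigenvalue X g0 g d : bKrank_le b X n ->
  mxK b g0 -> mxK b g -> pX X g0 != 0 -> pX X (g - d *: g0) = 0 -> inK b d.
Proof.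
move=> Xn g0K gK p0 pd; apply/implyP => b1.
have := @bKrank_le_bound n n K X b n (`|complex.Im d| ^+ n)
  (fun Y => pX Y (g - d *: g0)) (fun Y => pX Y g0) Xn _ _ _ _.
rewrite pd cmod0 => h.
have {}h : `|complex.Im d| ^+ n * cmod (pX X g0) <= 0.
  apply: h; first exact: exprn_ge0.
  - by apply: tcont_det; apply: tcont_slice_mix.
  - by apply: tcont_det; apply: tcont_slice_mix.
  move=> Y [A [B [Cm Yc]]]; rewrite !(pX_cpd _ Yc) !cmodM mulrCA.
  rewrite ler_wpM2l ?mulr_ge0 ?cmod_ge0 // !cmod_prod.
  rewrite -[n in _ ^+ n]card_ord -prodr_const -big_split /=.
  apply: ler_prod => r _; rewrite mulr_ge0 ?cmod_ge0 ?normr_ge0 //=.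
  have [_ _ CK _] := Yc.
  have real_form (u : 'cV[C]_K) : mxK b u -> complex.Im ((u^T *m Cm) 0 r) = 0.
    by move=> uK; have := mxKM (mxK_tr uK) CK 0 r; rewrite /inK b1 => /eqP.
  rewrite linearB linearZ /= mulmxBl -scalemxAl [X in _ <= cmod X]mxE.
  rewrite [X in cmod (_ + X)]mxE [X in cmod (_ - X)]mxE.
  have := real_form _ gK; have := real_form _ g0K.
  move: ((g0^T *m Cm) 0 r) ((g^T *m Cm) 0 r) => [a0 a0'] [a a'] /= -> ->.
  apply: le_trans (cmod_ge_Im _); case: (d) => dr di /=.
  have -> : cmod (a0 +i* 0)%C = `|a0| by rewrite /cmod /= expr0n addr0 sqrtr_sqr.
  by rewrite -normrM -[leRHS]normrN (_ : - _ = di * a0) //; ring.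
move: h; rewrite pmulr_lle0 ?cmod_gt0 // => h.
have : `|complex.Im d| ^+ n == 0 by rewrite eq_le h exprn_ge0.
by rewrite expf_eq0 normr_eq0 => /andP[].
Qed.

End SliceMix.
End BorderRank.

(** * Assembly of the bounds *)

Section Main.
Variable R : realType.
Local Notation C := (R[i]).

Lemma bKrank_le_mxK_slice b n K (W : tensor R n n K) m l :
  bKrank_le b W m -> mxK b (slice W l).
Proof.
move=> Wm i j; rewrite mxE; apply/implyP => b1; rewrite -normr_eq0.
apply/eqP; apply: le_anti; rewrite normr_ge0 andbT; apply/ler_addgt0Pr => e e0.
rewrite add0r; have [Y [[A [B [Cm [AK BK CK YE]]]] WY]] := Wm e e0.
have Y0 : complex.Im (Y i j l) = 0.
  have : inK b (Y i j l).
    apply/inKP => _; rewrite YE /cpd rmorph_sum; apply: eq_bigr => r _.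
    by rewrite !rmorphM /= ((inKP b _).1 (AK i r)) // ((inKP b _).1 (BK j r)) //
      ((inKP b _).1 (CK l r)).
  by rewrite /inK b1 => /eqP.
apply: ltW; apply: le_lt_trans (WY i j l).
have -> : complex.Im (W i j l) = complex.Im (W i j l - Y i j l).
  by move: Y0; case: (W i j l) (Y i j l) => [a a'] [c c'] /= ->; rewrite subr0.
exact: cmod_ge_Im.
Qed.

Lemma bKrank_le_spectrum b n K (W : tensor R n n K) :
  slice_mix_invertible b W -> bKrank_le b W n ->
  (exists L : 'M[C]_(K, n), is_spectrum b W L) /\
  forall (L : 'M[C]_(K, n)) i, is_spectrum b W L -> JGE_value b W (col i L).
Proof.
move=> [g0 [g0K Mu]] Wn.
have p0 : pX W g0 != 0 by rewrite /pX -unitfE -unitmxE.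
have WK l : mxK b (slice W l) := bKrank_le_mxK_slice l Wn.
have Ncomm k l : comm_mx (invmx (slice_mix W g0) *m slice W k)
                         (invmx (slice_mix W g0) *m slice W l).
  have := @bKrank_le_slices_comm R b n K W g0 (delta_mx k 0) (delta_mx l 0) Wn p0.
  rewrite !slice_mix_delta => h; rewrite /comm_mx -!mulmxA; congr (_ *m _).
  by rewrite !mulmxA.
have Wreal l d : pX W (delta_mx l 0 - d *: g0) = 0 -> inK b d.
  by apply: bKrank_le_real_eigenvalue Wn g0K _ p0; exact: mxK_delta.
split; first exact: (spectrum_exists g0K Mu WK Ncomm Wreal).
by move=> L i; exact: (spectrum_JGE g0K Mu WK Ncomm Wreal).
Qed.

(** Everything reduces to the first inequality for JGE values: projecting the third mode does not
    increase the spectral norm, inverting A and B costs the smallest singular values, and every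
    spectrum element of W is a JGE value. *)
Lemma bounds_of_JGE b n K (T W : tensor R n n K) (A B : 'M[C]_n) (Cm : 'M[C]_(K, n))
    (s : R) :
  is_cpd b T A B Cm -> A \in unitmx -> B \in unitmx -> 0 <= s ->
  (forall w, JGE_value b W w ->
     \big[Num.min/1]_(k < n) chordal (col k Cm) w
       <= s * spnorm b (mode3 (mode2 (mode1 (tsub T W) (invmx A)) (invmx B)) (proj_perp w))) ->
  bounds b T W A B Cm s.
Proof.
move=> Tcpd Au Bu s0 JGE; rewrite /bounds /=.
set X := mode2 _ _.
have Xle : s * spnorm b X <= s * spnorm b (tsub T W) / (sigma_min A * sigma_min B).
  by rewrite -mulrA ler_wpM2l //; exact: (spnorm_mode12_le W Tcpd).
split=> [w wJ|Winv [Wn _]].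
  split; first exact: JGE.
  have [wK w0 _] := wJ.
  by apply: le_trans Xle; rewrite ler_wpM2l //; exact: spnorm_mode3_proj_le.
have [Lex LJ] := bKrank_le_spectrum Winv Wn; split=> // L Lsp; split=> //.
apply: bigmax_le; first by rewrite mulr_ge0 ?spnorm_ge0.
move=> i _; have wJ := LJ L i Lsp; have [wK w0 _] := wJ.
by apply: le_trans (JGE _ wJ) _; rewrite ler_wpM2l //; exact: spnorm_mode3_proj_le.
Qed.

End Main.

(* realK = true : K = R ; realK = false : K = C.  n plays the role of R,
   K the third dimension. *)
Theorem theorem4p3 (R : realType) (realK : bool) (n K : nat)
  (T W : tensor R n n K) (A B : 'M[R[i]]_n) (Cm : 'M[R[i]]_(K, n)) :
  Krank realK T n ->
  is_cpd realK T A B Cm ->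
  A \in unitmx -> B \in unitmx ->
  (forall r : 'I_n, vnorm (col r Cm) = 1) ->
  bounds realK T W A B Cm (Num.sqrt (n%:R)) /\
  ((K = 2)%N \/
   (slice_mix_invertible realK W /\ Krank realK W n /\
    exists (Aw Bw : 'M[R[i]]_n) (Cw : 'M[R[i]]_(K, n)),
      is_cpd realK W Aw Bw Cw /\ (Aw = A \/ Bw = B)) ->
   bounds realK T W A B Cm 1).
Proof.
move=> _ Tcpd Au Bu Cm1; split.
  apply: bounds_of_JGE => // [|w [wK w0 [x [y [xK yK x0 y0 wxy]]]]].
    exact: sqrtr_ge0.
  exact: (JGE_bound_sqrt Tcpd Au Bu Cm1 wxy).
move=> special; apply: bounds_of_JGE => // w [wK w0 [x [y [xK yK x0 y0 wxy]]]].
rewrite mul1r; case: special => [K2|[[g [gK gu]] [_ [Aw [Bw [Cw [Wcpd AB]]]]]]].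
  move: T W Cm Tcpd Cm1 w wK w0 wxy; rewrite K2 => T W Cm Tcpd Cm1 w wK w0 wxy.
  exact: (JGE_bound_dim2 Tcpd Au Bu Cm1 wK w0 xK x0 wxy).
(* The determinant of the invertible mix contains det Aw and det Bw as factors, so both are
   nonzero. *)
move: gu; rewrite unitmxE unitfE -/(pX W g) (pX_cpd g Wcpd) !mulf_eq0 !negb_or.
case/andP => /andP[dA dB] _.
have Awu : Aw \in unitmx by rewrite unitmxE unitfE.
have Bwu : Bw \in unitmx by rewrite unitmxE unitfE.
exact: (JGE_bound_cpd Tcpd Au Bu Cm1 wxy w0 wK x0 Bwu Awu Wcpd AB).
Qed.
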